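(* There exist a set $F=\{z_1,z_2,z_3\}$ of three distinct non-zero points in the open unit disk $\mathbb{D}$, an integer $k\ge 1$, and $k\times k$ complex matrices $W_1,W_2,W_3$ such that the $3\times 3$ block matrix \[ \big[(I_k-W_iW_j^* )\,K^{\alpha,\beta}(z_i,z_j)\big]_{i,j=1}^3 \] is positive semidefinite for all $(\alpha,\beta)\in\mathbb{C}^2$ with $|\alpha|^2+|\beta|^2=1$, but there does not exist a function $f\in\mathfrak{M}_k(H^\infty_1)$ with $\|f\|_\infty\le 1$ such that $f(z_i)=W_i$ for $i=1,2,3$.
   Context: $H^\infty_1$ is the algebra of bounded analytic functions $f$ on $\mathbb{D}$ with $f'(0)=0$. $\mathfrak{M}_k$ denotes the $k\times k$ complex matrices with operator norm, and $\mathfrak{M}_k(H^\infty_1)$ denotes $k\times k$ matrices with entries in $H^\infty_1$, viewed as $\mathfrak{M}_k$-valued functions on $\mathbb{D}$, with norm $\|f\|_\infty=\sup_{z\in\mathbb{D}}\|f(z)\|$. For $|\alpha|^2+|\beta|^2=1$ and $z,w\in\mathbb{D}$, \[ K^{\alpha,\beta}(z,w)=(\alpha+\beta z)\overline{(\alpha+\beta w)}+\frac{z^2\overline{w}^2}{1-z\overline{w}}. \] *)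

(* Defs.v *)
From mathcomp Require Import all_boot all_order all_algebra.
From mathcomp Require Import all_classical all_reals all_analysis.
From mathcomp Require Import complex.
Import numFieldNormedType.Exports.
Import ComplexField.Normc.

Set Implicit Arguments.
Unset Strict Implicit.
Unset Printing Implicit Defensive.

Import Order.TTheory GRing.Theory Num.Theory.
Local Open Scope ring_scope.
Local Open Scope classical_set_scope.
Local Open Scope sesquilinear_scope.

Section Defs.
Variable R : realType.
Local Notation C := R[i].

Definition disk : set C := [set z | `|z| < 1].

(* The regular module C^o carries the normed C-module structure, so the
   difference quotients range over complex increments. *)
Definition analytic_on_disk (g : C -> C) : Prop :=
  forall z, disk z -> derivable (g : C^o -> C^o) z 1.

Definition Hoo1 (g : C -> C) : Prop :=
  [/\ analytic_on_disk g,
      exists B : R, forall z, disk z -> normc (g z) <= B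
    & (g : C^o -> C^o)^`() 0 = 0].

(* Values of f outside the disk are irrelevant. *)
Definition mxHoo1 k (f : C -> 'M[C]_k) : Prop :=
  forall i j, Hoo1 (fun z => f z i j).

Definition l2norm n (v : 'cV[C]_n) : R :=
  Num.sqrt (\sum_i normc (v i 0) ^+ 2).

Definition opnorm k (A : 'M[C]_k) : R :=
  sup [set l2norm (A *m v) | v in [set v | l2norm v <= 1]].

Definition supnorm k (f : C -> 'M[C]_k) : \bar R :=
  ereal_sup [set (opnorm (f z))%:E | z in disk].

(* In R[i], 0 <= x also asserts that x is real. *)
Definition psdmx n (M : 'M[C]_n) : Prop :=
  forall v : 'cV[C]_n, 0 <= (v ^t* *m M *m v) 0 0.

Definition Kab (a b z w : C) : C :=
  (a + b * z) * (a + b * w)^* + z ^+ 2 * w^* ^+ 2 / (1 - z * w^*).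

End Defs.

(* Main.v *)
Require Import Defs.
From mathcomp Require Import all_boot all_order all_algebra.
From mathcomp Require Import all_classical all_reals all_analysis.
From mathcomp Require Import complex ring lra.
Import numFieldNormedType.Exports.

Set Implicit Arguments.
Unset Strict Implicit.
Unset Printing Implicit Defensive.

Import Order.TTheory GRing.Theory Num.Theory.
Local Open Scope ring_scope.
Local Open Scope classical_set_scope.
Local Open Scope sesquilinear_scope.

(** In the limit of nodes tending to 0 in general position, f modulo the
    functions vanishing at the nodes is f_0 + f_2 z^2 + f_3 z^3, and
    interpolation with f_0 = 0 amounts to contractivity of the block matrix
    M = [[f_2, 0], [f_3, f_2]], whereas the kernels K^{alpha,beta} only test M on
    product vectors, on the left and on the right.  For f_2 = c I and
    f_3 = c E_12 the norm of M is c times the golden ratio and is attained at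
    entangled vectors only, while product vectors see at most c sqrt 2.  So
    W_i = c (z_i^2 I + z_i^3 E_12) with 5/8 < c < 1/sqrt 2 (here c = 13/20)
    separates the two conditions once the nodes 1/100, -1/100, 1/1000 are close
    enough to the limit.

    Scalar conditions: in terms of the moments u_m = sum_i z_i^m u_i, the
    quadratic form is controlled by u_2, u_3, u_4, and the linear relation between
    them and alpha u_0 + beta u_1 forces either u_4 or alpha to be small.

    Nonexistence: with l = (2, z) and v = (z, 2), the function l f v is bounded
    by 5 on the disk and takes the values 8 c z_i^3 at the nodes; divided by
    the polynomial of the nodes and evaluated at 0 by the maximum principle this
    gives 8 c <= 5 up to an error which f'(0) = 0 makes small. *)

Section Development.
Import ComplexField.Normc.
Local Open Scope complex_scope.
Local Notation Re := complex.Re.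
Local Notation Im := complex.Im.

(** * Integrals of complex functions along segments *)

Section ComplexSegmentIntegral.
Context {R : realType}.
Local Notation C := R[i].
Local Notation mu := (@lebesgue_measure R).

Lemma ler_Re_normc (z : C) : `|Re z| <= normc z.
Proof.
case: z => x y /=; rewrite -sqrtr_sqr ler_sqrt ?addr_ge0 ?sqr_ge0//.
by rewrite lerDl sqr_ge0.
Qed.

Lemma ler_Im_normc (z : C) : `|Im z| <= normc z.
Proof.
case: z => x y /=; rewrite -sqrtr_sqr ler_sqrt ?addr_ge0 ?sqr_ge0//.
by rewrite lerDr sqr_ge0.
Qed.

Lemma ler_normc_ReIm (z : C) : normc z <= `|Re z| + `|Im z|.
Proof.
case: z => x y /=; rewrite -[leRHS]ger0_norm ?addr_ge0// -sqrtr_sqr.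
rewrite ler_sqrt ?sqr_ge0// -(real_normK (num_real x)) -(real_normK (num_real y)).
have := normr_ge0 x; have := normr_ge0 y; nra.
Qed.

Lemma normc_ge0 (z : C) : 0 <= normc z.
Proof. by case: z => x y; exact: sqrtr_ge0. Qed.

Lemma normcB (z w : C) : normc (z - w) = normc (w - z).
Proof. by rewrite -opprB normcN. Qed.

Lemma ler_normcB (z w : C) : normc (z - w) <= normc z + normc w.
Proof. by rewrite (le_trans (le_normcD _ _))// normcN. Qed.

Lemma ReB (z w : C) : Re (z - w) = Re z - Re w.
Proof. by case: z w => ? ? []. Qed.

Lemma ImB (z w : C) : Im (z - w) = Im z - Im w.
Proof. by case: z w => ? ? []. Qed.

(** The epsilon-delta form with the real-valued [normc] avoids the norm of [R[i]], whose values are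
    complex, and passes directly to real and imaginary parts. *)
Definition ccont (f : R -> C) (t : R) :=
  forall e : R, 0 < e ->
    exists2 d : R, 0 < d & forall t', `|t' - t| < d -> normc (f t' - f t) < e.

Lemma ccontB f g t : ccont f t -> ccont g t -> ccont (fun x => f x - g x) t.
Proof.
move=> cf cg e e0.
have e20 : 0 < e / 2 by rewrite divr_gt0.
have [d1 d10 fd] := cf _ e20; have [d2 d20 gd] := cg _ e20.
exists (Num.min d1 d2); first by rewrite lt_min d10.
move=> t'; rewrite lt_min => /andP[/fd fe /gd ge].
rewrite (_ : _ - _ = (f t' - f t) - (g t' - g t)); last by ring.
by rewrite (le_lt_trans (ler_normcB _ _))// [e in _ < e]splitr ltrD.
Qed.

Lemma ccont_Re f t : ccont f t -> {for t, continuous (fun x => Re (f x))}.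
Proof.
move=> cf; apply/cvgrPdist_lt => e /cf[d d0 fd]; near=> x.
by rewrite -ReB (le_lt_trans (ler_Re_normc _))// normcB fd.
Unshelve. all: by end_near. Qed.

Lemma ccont_Im f t : ccont f t -> {for t, continuous (fun x => Im (f x))}.
Proof.
move=> cf; apply/cvgrPdist_lt => e /cf[d d0 fd]; near=> x.
by rewrite -ImB (le_lt_trans (ler_Im_normc _))// normcB fd.
Unshelve. all: by end_near. Qed.

Definition cint (f : R -> C) (a b : R) : C :=
  (\int[mu]_(t in `[a, b]) Re (f t)) +i* (\int[mu]_(t in `[a, b]) Im (f t)).

Lemma continuous_itv_integrable (f : R -> R) (a b : R) :
  (forall t, a <= t <= b -> {for t, continuous f}) ->
  mu.-integrable `[a, b] (EFin \o f).
Proof.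
move=> cf; apply: continuous_compact_integrable; first exact: segment_compact.
apply: continuous_in_subspaceT => t; rewrite inE/= in_itv/=; exact: cf.
Qed.

Lemma ccont_integrable f a b : (forall t, a <= t <= b -> ccont f t) ->
  mu.-integrable `[a, b] (EFin \o (fun t => Re (f t))) /\
  mu.-integrable `[a, b] (EFin \o (fun t => Im (f t))).
Proof.
move=> cf; split; apply: continuous_itv_integrable => t tab.
  exact/ccont_Re/cf.
exact/ccont_Im/cf.
Qed.

Lemma Rintegral_itv_split (f : R -> R) (a b c : R) : a <= b -> b <= c ->
  mu.-integrable `[a, c] (EFin \o f) ->
  \int[mu]_(t in `[a, c]) f t =
  \int[mu]_(t in `[a, b]) f t + \int[mu]_(t in `[b, c]) f t.
Proof.
move=> ab bc fi; have /(_ b) := Rintegral_itvB fi.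
rewrite bnd_simp => /(_ ab bc) /(canRL (addrNK _)) ->.
rewrite addrC Rintegral_itv_obnd_cbnd//.
by apply: integrableS fi => //; apply: subset_itvr; rewrite bnd_simp.
Qed.

Lemma cint_split f a b c : a <= b -> b <= c ->
  (forall t, a <= t <= c -> ccont f t) -> cint f a c = cint f a b + cint f b c.
Proof.
move=> ab bc /ccont_integrable[fr fi].
by rewrite /cint (Rintegral_itv_split ab bc fr) (Rintegral_itv_split ab bc fi).
Qed.

Lemma cintB f g a b : (forall t, a <= t <= b -> ccont f t) ->
  (forall t, a <= t <= b -> ccont g t) ->
  cint (fun t => f t - g t) a b = cint f a b - cint g a b.
Proof.
move=> /ccont_integrable[fr fi] /ccont_integrable[gr gi]; rewrite /cint.
apply/eqP; rewrite eq_complex /= -!RintegralB//; apply/andP.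
by split; apply/eqP; apply: eq_Rintegral => t _; rewrite ?ReB ?ImB.
Qed.

Lemma eq_cint f g a b : (forall t, a <= t <= b -> f t = g t) ->
  cint f a b = cint g a b.
Proof.
move=> fg; rewrite /cint; congr (_ +i* _); apply: eq_Rintegral => t;
  by rewrite inE/= in_itv/= => /fg ->.
Qed.

Lemma lebesgue_itvcc (a b : R) : a <= b -> fine (mu `[a, b]%classic) = b - a.
Proof.
move=> ab; rewrite lebesgue_measure_itv/= lte_fin.
by case: ltP => //= ba; apply/eqP; rewrite eq_sym subr_eq0 eq_le ab ba.
Qed.

Lemma Rintegral_itv_bound (f : R -> R) (a b M : R) : a <= b ->
  (forall t, a <= t <= b -> {for t, continuous f}) ->
  (forall t, a <= t <= b -> `|f t| <= M) ->
  `|\int[mu]_(t in `[a, b]) f t| <= M * (b - a).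
Proof.
move=> ab cf fM; have fi := continuous_itv_integrable cf.
rewrite (le_trans (le_normr_Rintegral _ fi))// -(lebesgue_itvcc ab).
rewrite -Rintegral_cst//; apply: le_Rintegral => //=.
- apply: continuous_itv_integrable => t tab.
  by apply: continuous_comp; [exact: cf|exact: norm_continuous].
- by apply: continuous_itv_integrable => t tab; exact: cvg_cst.
Qed.

Lemma Rintegral_itv_lbound (f : R -> R) (a b m : R) : a <= b ->
  (forall t, a <= t <= b -> {for t, continuous f}) ->
  (forall t, a <= t <= b -> m <= f t) ->
  m * (b - a) <= \int[mu]_(t in `[a, b]) f t.
Proof.
move=> ab cf fM; have fi := continuous_itv_integrable cf.
rewrite -(lebesgue_itvcc ab) -Rintegral_cst//; apply: le_Rintegral => //=.
- by apply: continuous_itv_integrable => t tab; exact: cvg_cst.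
Qed.

(** Real and imaginary parts are bounded separately, at the cost of a factor 2. Such losses are
    harmless, since [square_strict_max] removes constants by taking powers. *)
Lemma cint_bound f a b M : a <= b -> (forall t, a <= t <= b -> ccont f t) ->
  (forall t, a <= t <= b -> normc (f t) <= M) ->
  normc (cint f a b) <= 2 * M * (b - a).
Proof.
move=> ab cf fM; rewrite (le_trans (ler_normc_ReIm _))// -mulrA mulr_natl mulr2n.
apply: lerD; apply: Rintegral_itv_bound => // t tab.
- exact/ccont_Re/cf.
- exact: le_trans (ler_Re_normc _) (fM _ tab).
- exact/ccont_Im/cf.
- exact: le_trans (ler_Im_normc _) (fM _ tab).
Qed.

Lemma cint_cst (k : C) a b : a <= b -> cint (fun=> k) a b = k * (b - a)%:C.
Proof.
move=> ab; rewrite /cint !Rintegral_cst// lebesgue_itvcc//.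
by case: k => x y; apply/eqP; rewrite eq_complex/= !mulr0 subr0 add0r !eqxx.
Qed.

Lemma ccont_cst k t : ccont (fun=> k) t.
Proof. by move=> e e0; exists 1 => // t' _; rewrite subrr normc0. Qed.

End ComplexSegmentIntegral.

(** * Goursat's theorem on rectangles *)

Section Bisection.
Context {R : realType}.

(* P x y u v is about the rectangle [x, x + u] x [y, y + v]. *)
Lemma rectangle_bisection (P : R -> R -> R -> R -> Prop) (x y u v : R) :
  0 <= u -> 0 <= v ->
  (forall x y u v, 0 <= u -> 0 <= v ->
     P x y u v -> P (x + u) y u v -> P x (y + v) u v -> P (x + u) (y + v) u v ->
     P x y (u + u) (v + v)) ->
  (forall a b, x <= a <= x + u -> y <= b <= y + v ->
     exists2 d, 0 < d & forall x' y' u' v', 0 <= u' < d -> 0 <= v' < d ->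
       x' <= a <= x' + u' -> y' <= b <= y' + v' -> P x' y' u' v') ->
  P x y u v.
Proof.
move=> u0 v0 Pglue Ploc; apply: contrapT => nP.
(* From a rectangle with corner [p] and doubled sides on which [P] fails, [step] moves to the corner
   of a quarter on which [P] still fails. *)
pose step (p : R * R) u v : R * R :=
  if `[< ~ P p.1 p.2 u v >] then p
  else if `[< ~ P (p.1 + u) p.2 u v >] then (p.1 + u, p.2)
  else if `[< ~ P p.1 (p.2 + v) u v >] then (p.1, p.2 + v)
  else (p.1 + u, p.2 + v).
have stepP p u1 v1 : 0 <= u1 -> 0 <= v1 -> ~ P p.1 p.2 (u1 + u1) (v1 + v1) ->
    ~ P (step p u1 v1).1 (step p u1 v1).2 u1 v1.
  move=> u10 v10; rewrite /step; case: asboolP => // /contrapT P1.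
  case: asboolP => // /contrapT P2; case: asboolP => // /contrapT P3 nP4 P4.
  by apply: nP4; apply: Pglue.
have step1 p u1 v1 : 0 <= u1 -> p.1 <= (step p u1 v1).1 <= p.1 + u1.
  by rewrite /step; do ?[case: ifP => _] => /=; lra.
have step2 p u1 v1 : 0 <= v1 -> p.2 <= (step p u1 v1).2 <= p.2 + v1.
  by rewrite /step; do ?[case: ifP => _] => /=; lra.
pose U n := u / 2 ^+ n; pose V n := v / 2 ^+ n.
have halve (w : R) n : w / 2 ^+ n.+1 + w / 2 ^+ n.+1 = w / 2 ^+ n.
  by rewrite exprS; field; rewrite expf_neq0.
have U0 n : 0 <= U n by rewrite divr_ge0// exprn_ge0.
have V0 n : 0 <= V n by rewrite divr_ge0// exprn_ge0.
pose s := fix s n := if n is m.+1 then step (s m) (U m.+1) (V m.+1) else (x, y).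
have sP n : ~ P (s n).1 (s n).2 (U n) (V n).
  elim: n => [|n IH /=]; first by rewrite /U /V expr0 !divr1.
  by apply: stepP => //; rewrite !halve.
have nest1 n k : (s n).1 <= (s (n + k)%N).1 /\ (s (n + k)%N).1 + U (n + k)%N <= (s n).1 + U n.
  elim: k => [|k [IH1 IH2]]; first by rewrite addn0.
  rewrite addnS; have := step1 (s (n + k)%N) (U (n + k).+1) (V (n + k).+1) (U0 _).
  by have := halve u (n + k)%N; rewrite -!/(U _) /=; lra.
have nest2 n k : (s n).2 <= (s (n + k)%N).2 /\ (s (n + k)%N).2 + V (n + k)%N <= (s n).2 + V n.
  elim: k => [|k [IH1 IH2]]; first by rewrite addn0.
  rewrite addnS; have := step2 (s (n + k)%N) (U (n + k).+1) (V (n + k).+1) (V0 _).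
  by have := halve v (n + k)%N; rewrite -!/(V _) /=; lra.
(* Nested intervals: the supremum of the left endpoints lies in all of them. *)
have nest (t W : nat -> R) :
    (forall n, 0 <= W n) ->
    (forall n k, t n <= t (n + k)%N /\ t (n + k)%N + W (n + k)%N <= t n + W n) ->
    exists a, forall n, t n <= a <= t n + W n.
  move=> W0 tW; have tub n : ubound (range t) (t n + W n).
    move=> _ [m _ <-]; have [mn|nm] := leqP m n.
      have [+ _] := tW m (n - m)%N; rewrite subnKC//.
      by have := W0 n; lra.
    have [_ +] := tW n (m - n)%N; rewrite subnKC ?(ltnW nm)//.
    by have := W0 m; lra.
  exists (sup (range t)) => n; apply/andP; split.
    by apply: ub_le_sup; [exists (t 0%N + W 0%N); exact: tub|exists n].
  by apply: ge_sup => //; exists (t 0%N); exists 0%N.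
have [a ha] := nest (fun n => (s n).1) U U0 nest1.
have [b hb] := nest (fun n => (s n).2) V V0 nest2.
have [||d d0 dP] := Ploc a b.
- by have := ha 0%N; rewrite /U expr0 divr1.
- by have := hb 0%N; rewrite /V expr0 divr1.
(* Both sides of the n-th rectangle are then below [d], so the local hypothesis at the limit point
   contradicts [sP]. *)
have [n hn] : exists n, u + v < d * 2 ^+ n.
  exists (Num.truncn ((u + v) / d)).+1.
  rewrite -ltr_pdivrMl// mulrC (lt_le_trans (truncnS_gt _))//.
  by rewrite -natrX ler_nat ltnW// ltn_expl.
have p2 : (0 : R) < 2 ^+ n by rewrite exprn_gt0.
apply: (sP n); apply: dP; rewrite ?U0 ?V0//=; rewrite ?ltr_pdivrMr//; lra.
Qed.

End Bisection.

Section Goursat.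
Context {R : realType}.
Local Notation C := R[i].

Definition contc (f : C -> C) (z : C) :=
  forall e : R, 0 < e -> exists2 d : R, 0 < d &
    forall w, normc (w - z) < d -> normc (f w - f z) < e.

Definition cderiv (f : C -> C) (z l : C) :=
  forall e : R, 0 < e -> exists2 d : R, 0 < d &
    forall w, normc (w - z) < d ->
      normc (f w - f z - l * (w - z)) <= e * normc (w - z).

Definition cdiff (f : C -> C) (z : C) := exists l, cderiv f z l.

(** The counterclockwise contour integral over the boundary of the rectangle, with opposite sides
    paired under one integral sign. *)
Definition crect (f : C -> C) (x y u v : R) : C :=
  cint (fun t => f (t +i* y) - f (t +i* (y + v))) x (x + u) +
  (0 +i* 1) * cint (fun t => f ((x + u) +i* t) - f (x +i* t)) y (y + v).

Definition rectangle (x y u v : R) : set C :=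
  [set z | x <= Re z <= x + u /\ y <= Im z <= y + v].

Lemma normc_real (x : R) : normc (x +i* 0) = `|x|.
Proof. by rewrite /= expr0n addr0 sqrtr_sqr. Qed.

Lemma normc_imag (y : R) : normc (0 +i* y) = `|y|.
Proof. by rewrite /= expr0n add0r sqrtr_sqr. Qed.

Lemma contc_hline f (t y : R) : contc f (t +i* y) -> ccont (fun t => f (t +i* y)) t.
Proof.
move=> cf e /cf[d d0 fd]; exists d => // t' t'd; apply: fd.
by rewrite [_ - _](_ : _ = (t' - t) +i* 0) ?normc_real//=; congr Complex; ring.
Qed.

Lemma contc_vline f (x t : R) : contc f (x +i* t) -> ccont (fun t => f (x +i* t)) t.
Proof.
move=> cf e /cf[d d0 fd]; exists d => // t' t'd; apply: fd.
by rewrite [_ - _](_ : _ = 0 +i* (t' - t)) ?normc_imag//=; congr Complex; ring.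
Qed.

(** Continuity is asked only along the sides and the cut, so that a rectangle with a singularity
    inside can also be cut. *)
Lemma crect_splitx f x y u1 u2 v : 0 <= u1 -> 0 <= u2 -> 0 <= v ->
  (forall z, rectangle x y (u1 + u2) v z ->
     [|| Im z == y, Im z == y + v, Re z == x, Re z == x + u1
       | Re z == x + u1 + u2] -> contc f z) ->
  crect f x y (u1 + u2) v = crect f x y u1 v + crect f (x + u1) y u2 v.
Proof.
move=> u10 u20 v0 cf; rewrite /crect addrA (@cint_split _ _ x (x + u1)); first last.
- by move=> t xt; apply: ccontB; apply: contc_hline;
    (apply: cf; [split => /=; lra|by rewrite /= ?eqxx ?orbT]).
- by lra.
- by lra.
rewrite [cint _ y _ in LHS](_ : _ =
    cint (fun t => f ((x + u1 + u2) +i* t) - f ((x + u1) +i* t)) y (y + v) +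
    cint (fun t => f ((x + u1) +i* t) - f (x +i* t)) y (y + v)); first by ring.
apply/eqP; rewrite -subr_eq; apply/eqP; rewrite -cintB.
- by apply: eq_cint => t _; ring.
- by move=> t yt; apply: ccontB; apply: contc_vline;
    (apply: cf; [split => /=; lra|by rewrite /= ?eqxx ?orbT]).
- by move=> t yt; apply: ccontB; apply: contc_vline;
    (apply: cf; [split => /=; lra|by rewrite /= ?eqxx ?orbT]).
Qed.

Lemma crect_splity f x y u v1 v2 : 0 <= u -> 0 <= v1 -> 0 <= v2 ->
  (forall z, rectangle x y u (v1 + v2) z ->
     [|| Re z == x, Re z == x + u, Im z == y, Im z == y + v1
       | Im z == y + v1 + v2] -> contc f z) ->
  crect f x y u (v1 + v2) = crect f x y u v1 + crect f x (y + v1) u v2.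
Proof.
move=> u0 v10 v20 cf; rewrite /crect !addrA (@cint_split _ _ y (y + v1)); first last.
- by move=> t xt; apply: ccontB; apply: contc_vline;
    (apply: cf; [split => /=; lra|by rewrite /= ?eqxx ?orbT]).
- by lra.
- by lra.
rewrite [cint _ x _ in LHS](_ : _ =
    cint (fun t => f (t +i* y) - f (t +i* (y + v1))) x (x + u) +
    cint (fun t => f (t +i* (y + v1)) - f (t +i* (y + v1 + v2))) x (x + u)); first by ring.
apply/eqP; rewrite [eqbRHS]addrC -subr_eq; apply/eqP; rewrite -cintB.
- by apply: eq_cint => t _; ring.
- by move=> t yt; apply: ccontB; apply: contc_hline;
    (apply: cf; [split => /=; lra|by rewrite /= ?eqxx ?orbT]).
- by move=> t yt; apply: ccontB; apply: contc_hline;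
    (apply: cf; [split => /=; lra|by rewrite /= ?eqxx ?orbT]).
Qed.

(* The contour integral of an affine function vanishes, so only the deviation
   of f from k + l * w counts. *)
Lemma crect_bound f x y u v (k l : C) (m : R) : 0 <= u -> 0 <= v ->
  (forall z, rectangle x y u v z ->
     [|| Im z == y, Im z == y + v, Re z == x | Re z == x + u] ->
     contc f z /\ normc (f z - (k + l * z)) <= m) ->
  normc (crect f x y u v) <= 4 * m * (u + v).
Proof.
move=> u0 v0 fm; set H := fun t => f (t +i* y) - f (t +i* (y + v)).
set V := fun t => f ((x + u) +i* t) - f (x +i* t).
have cH t : x <= t <= x + u -> ccont H t.
  by move=> xt; apply: ccontB; apply: contc_hline;
    (apply: (proj1 (fm _ _ _)); [split => /=; lra|by rewrite /= ?eqxx ?orbT]).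
have cV t : y <= t <= y + v -> ccont V t.
  by move=> xt; apply: ccontB; apply: contc_vline;
    (apply: (proj1 (fm _ _ _)); [split => /=; lra|by rewrite /= ?eqxx ?orbT]).
(* The affine function shifts the horizontal difference by a multiple of [v] and the vertical one by
   a multiple of [u]; after integration the two contributions cancel. *)
have -> : crect f x y u v = cint (fun t => H t - - (l * (0 +i* v))) x (x + u) +
    (0 +i* 1) * cint (fun t => V t - l * (u +i* 0)) y (y + v).
  rewrite (cintB cH (fun t _ => ccont_cst _ t)) (cintB cV (fun t _ => ccont_cst _ t)).
  rewrite !cint_cst; [|lra..]; rewrite /crect -/H -/V.
  rewrite (_ : x + u - x = u); last by ring.
  rewrite (_ : y + v - y = v); last by ring.
  rewrite (_ : 0 +i* v = (0 +i* 1) * v%:C :> C); last first.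
    by apply/eqP; rewrite eq_complex /=; apply/andP; split; apply/eqP; ring.
  by rewrite (_ : u +i* 0 = u%:C)//; ring.
have normi : normc (0 +i* 1 : C) = 1 by rewrite normc_imag normr1.
rewrite (le_trans (le_normcD _ _))// normcM normi mul1r mulrDr.
apply: lerD; (apply: le_trans;
  [apply: (@cint_bound _ _ _ _ (m + m)); first lra|lra]).
- by move=> t xt; apply: ccontB; [exact: cH|exact: ccont_cst].
- move=> t xt; rewrite /H.
  rewrite [X in normc X](_ : _ = (f (t +i* y) - (k + l * (t +i* y))) -
    (f (t +i* (y + v)) - (k + l * (t +i* (y + v))))).
    rewrite (le_trans (ler_normcB _ _))// lerD//;
      (apply: (proj2 (fm _ _ _)); [split => /=; lra|by rewrite /= ?eqxx ?orbT]).
  rewrite (_ : t +i* (y + v) = (t +i* y) + (0 +i* v)); first by ring.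
  by apply/eqP; rewrite eq_complex/= addr0 !eqxx.
- by move=> t xt; apply: ccontB; [exact: cV|exact: ccont_cst].
- move=> t xt; rewrite /V.
  rewrite [X in normc X](_ : _ = (f ((x + u) +i* t) - (k + l * ((x + u) +i* t))) -
    (f (x +i* t) - (k + l * (x +i* t)))).
    rewrite (le_trans (ler_normcB _ _))// lerD//;
      (apply: (proj2 (fm _ _ _)); [split => /=; lra|by rewrite /= ?eqxx ?orbT]).
  rewrite (_ : (x + u) +i* t = (x +i* t) + (u +i* 0)); first by ring.
  by apply/eqP; rewrite eq_complex/= addr0 !eqxx.
Qed.

Lemma cdiff_contc f z : cdiff f z -> contc f z.
Proof.
move=> [l fl] e e0; have [d d0 fd] := fl 1 ltr01.
pose m := 1 + normc l.
have m0 : 0 < m by rewrite ltr_pwDl// normc_ge0.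
exists (Num.min d (e / m)); first by rewrite lt_min d0 divr_gt0.
move=> w; rewrite lt_min => /andP[/fd fw]; rewrite ltr_pdivlMr// => wm.
rewrite (_ : _ - _ = (f w - f z - l * (w - z)) + l * (w - z)); last by ring.
rewrite (le_lt_trans (le_normcD _ _))// normcM (le_lt_trans _ wm)//.
by rewrite /m [leRHS]mulrDr mulr1 lerD// ?(le_trans fw) ?mul1r// mulrC.
Qed.

Lemma rectangle_diam x y u v (z w : C) :
  rectangle x y u v z -> rectangle x y u v w -> normc (w - z) <= u + v.
Proof.
move=> [zx zy] [wx wy]; rewrite (le_trans (ler_normc_ReIm _))// ReB ImB.
by apply: lerD; rewrite ler_norml; lra.
Qed.

(** Bisection is applied to the estimate by 4 * e * (u' + v')^2. It passes from the quarters to the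
    whole because doubling the sides multiplies the bound by 4, and it holds on small rectangles
    around a point because [f] differs there from its tangent map by at most e * (u' + v'). *)
Lemma goursat f x y u v : 0 <= u -> 0 <= v ->
  (forall z, rectangle x y u v z -> cdiff f z) -> crect f x y u v = 0.
Proof.
move=> u0 v0 df; have cf z : rectangle x y u v z -> contc f z.
  by move=> /df; exact: cdiff_contc.
apply: eq0_normc; apply/eqP; rewrite eq_le normc_ge0 andbT.
rewrite leNgt; apply/negP => N0.
(* With this choice 4 * e * (u + v)^2 equals the norm of the integral minus [e], so the estimate is
   a contradiction. *)
pose K := 4 * (u + v) ^+ 2 + 1.
have K0 : 0 < K by rewrite ltr_wpDl// mulr_ge0// sqr_ge0.
pose e := normc (crect f x y u v) / K.
have e0 : 0 < e by rewrite divr_gt0.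
suff : normc (crect f x y u v) <= 4 * e * (u + v) ^+ 2.
  rewrite leNgt => /negP; apply; rewrite (_ : normc _ = e * K).
    by rewrite /K; lra.
  by rewrite /e divfK// gt_eqF.
(* The inclusion is a premise because the local hypothesis of the bisection ranges over all small
   rectangles around a point, including those that leave the domain. *)
pose P x' y' u' v' := rectangle x' y' u' v' `<=` rectangle x y u v ->
  normc (crect f x' y' u' v') <= 4 * e * (u' + v') ^+ 2.
suff : P x y u v by exact.
apply: rectangle_bisection => // {N0}.
- move=> x' y' u' v' u'0 v'0 P1 P2 P3 P4 sub.
  have cf' z : rectangle x' y' (u' + u') (v' + v') z -> contc f z.
    by move=> /sub; exact: cf.
  rewrite crect_splitx//; [|lra|by move=> z /cf'].
  rewrite !crect_splity//; try lra; first last.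
  - by move=> z [zx zy] _; apply: cf'; split; lra.
  - by move=> z [zx zy] _; apply: cf'; split; lra.
  have {}P1 : normc (crect f x' y' u' v') <= 4 * e * (u' + v') ^+ 2.
    by apply: P1 => z [zx zy]; apply: sub; split; lra.
  have {}P2 : normc (crect f (x' + u') y' u' v') <= 4 * e * (u' + v') ^+ 2.
    by apply: P2 => z [zx zy]; apply: sub; split; lra.
  have {}P3 : normc (crect f x' (y' + v') u' v') <= 4 * e * (u' + v') ^+ 2.
    by apply: P3 => z [zx zy]; apply: sub; split; lra.
  have {}P4 : normc (crect f (x' + u') (y' + v') u' v') <= 4 * e * (u' + v') ^+ 2.
    by apply: P4 => z [zx zy]; apply: sub; split; lra.
  rewrite (le_trans (le_normcD _ _))//.
  rewrite (le_trans (lerD (le_normcD _ _) (le_normcD _ _)))//.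
  by move: P1 P2 P3 P4; nra.
- move=> a b xa yb; have [l /(_ e e0)[d d0 fd]] := df (a +i* b) (conj xa yb).
  exists (d / 2); first by rewrite divr_gt0.
  move=> x' y' u' v' u'd v'd x'a y'b sub.
  have dd z : rectangle x' y' u' v' z -> normc (z - (a +i* b)) <= u' + v'.
    by apply: rectangle_diam.
  have := @crect_bound f x' y' u' v' (f (a +i* b) - l * (a +i* b)) l (e * (u' + v')).
  rewrite expr2 !mulrA => -> //.
  + by case/andP: u'd.
  + by case/andP: v'd.
  + move=> z zr _; have zd := dd z zr; split; first exact/cf/sub.
    rewrite (_ : _ - _ = f z - f (a +i* b) - l * (z - (a +i* b))); last by ring.
    rewrite (le_trans (fd _ _))//; last by rewrite ler_pM2l.
    by rewrite (le_lt_trans zd)//; lra.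
Qed.

End Goursat.

(** * Cauchy's estimate at the centre of a square, up to a constant *)

Section LocalBound.
Context {R : realType}.
Local Notation C := R[i].

Lemma normcE_norm (z : C) : `|z| = (normc z)%:C.
Proof. by case: z. Qed.

Lemma ltr_normc (z : C) (e : R) : (`|z| < e%:C) = (normc z < e).
Proof. by rewrite normcE_norm ltcR. Qed.

Lemma gt0_realC (e : C) : 0 < e -> exists2 r : R, 0 < r & e = r%:C.
Proof.
case: e => x y; rewrite ltcE /= => /andP[/eqP -> x0].
by exists x.
Qed.

Lemma derivable_cderiv (f : C -> C) z :
  derivable (f : C^o -> C^o) z 1 -> cderiv f z ('D_1 (f : C^o -> C^o) z).
Proof.
rewrite /derivable /derive; set l := lim _ => /cvgrPdist_lt cf e e0.
have : 0 < e%:C :> C by rewrite ltcR.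
move=> /cf[d /= /gt0_realC[r r0 ->] fd]; exists r => // w wz.
have [->|wz0] := eqVneq w z; first by rewrite !subrr mulr0 subr0 normc0 mulr0.
have wz0' : w - z != 0 by rewrite subr_eq0.
have /= := fd (w - z); rewrite sub0r normrN ltr_normc => /(_ wz wz0').
rewrite /GRing.scale/= mulr1 subrK => h.
rewrite -lecR rmorphM /= -!normcE_norm.
rewrite (_ : _ - _ - _ = - ((l - (w - z)^-1 * (f w - f z)) * (w - z))).
  by rewrite normrN normrM ler_wpM2r// ltW.
by field.
Qed.

Lemma derivable_cdiff (f : C -> C) z :
  derivable (f : C^o -> C^o) z 1 -> cdiff f z.
Proof. by move=> /derivable_cderiv df; exists ('D_1 (f : C^o -> C^o) z). Qed.

Lemma crectB (f g : C -> C) x y u v : 0 <= u -> 0 <= v ->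
  (forall z, rectangle x y u v z ->
     [|| Im z == y, Im z == y + v, Re z == x | Re z == x + u] ->
     contc f z /\ contc g z) ->
  crect (fun z => f z - g z) x y u v = crect f x y u v - crect g x y u v.
Proof.
move=> u0 v0 fg; rewrite /crect.
rewrite [cint _ x _ in LHS](_ : _ =
  cint (fun t => f (t +i* y) - f (t +i* (y + v))) x (x + u) -
  cint (fun t => g (t +i* y) - g (t +i* (y + v))) x (x + u)).
  rewrite [cint _ y _ in LHS](_ : _ =
    cint (fun t => f ((x + u) +i* t) - f (x +i* t)) y (y + v) -
    cint (fun t => g ((x + u) +i* t) - g (x +i* t)) y (y + v)); first by ring.
  rewrite -cintB; first (by apply: eq_cint => t _; ring);
    by move=> t tI; apply: ccontB; apply: contc_vline;
      (apply fg; [split => /=; lra|by rewrite /= ?eqxx ?orbT]).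
rewrite -cintB; first (by apply: eq_cint => t _; ring);
  by move=> t tI; apply: ccontB; apply: contc_hline;
    (apply fg; [split => /=; lra|by rewrite /= ?eqxx ?orbT]).
Qed.

Local Ltac or4_lra := apply/or4P; first [by apply: Or41; lra | by apply: Or42; lra
  | by apply: Or43; lra | by apply: Or44; lra].

Local Ltac line_off line := let z := fresh "z" in let zr := fresh "zr" in
  intros z zr; case/or4P => [/eqP ?|/eqP ?|/eqP ?|/orP[]/eqP ?];
  (apply: (line _ _ _ _ z zr); [lra..|or4_lra]).

(** Cutting off strips on the left, the right, the bottom and the top leaves the small square. The
    strips miss [a], so each contributes 0 by Goursat's theorem. *)
Lemma crect_annulus (f : C -> C) (a : C) r s : 0 < r -> r <= s ->
  (forall z, rectangle (Re a - s) (Im a - s) (s + s) (s + s) z -> z != a -> cdiff f z) ->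
  crect f (Re a - s) (Im a - s) (s + s) (s + s) =
  crect f (Re a - r) (Im a - r) (r + r) (r + r).
Proof.
move=> r0 rs; have [d d0 ->] : exists2 d, 0 <= d & s = r + d.
  by exists (s - r); lra.
move=> df.
have off z :
    rectangle (Re a - (r + d)) (Im a - (r + d)) (r + d + (r + d)) (r + d + (r + d)) z ->
    [|| Re z <= Re a - r, Re a + r <= Re z, Im z <= Im a - r | Im a + r <= Im z] ->
    cdiff f z.
  move=> zr ra; apply: df => //; apply: contraL ra => /eqP ->.
  by rewrite !negb_or -!ltNge; apply/and4P; split; lra.
have line x y u v z : rectangle x y u v z ->
    Re a - (r + d) <= x -> Im a - (r + d) <= y ->
    x + u <= Re a + (r + d) -> y + v <= Im a + (r + d) ->
    [|| Re z <= Re a - r, Re a + r <= Re z, Im z <= Im a - r | Im a + r <= Im z] ->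
    contc f z.
  by move=> [zx zy] *; apply/cdiff_contc/off => //; split; lra.
have zero x y u v : 0 <= u -> 0 <= v ->
    Re a - (r + d) <= x -> Im a - (r + d) <= y ->
    x + u <= Re a + (r + d) -> y + v <= Im a + (r + d) ->
    [|| x + u <= Re a - r, Re a + r <= x, y + v <= Im a - r | Im a + r <= y] ->
    crect f x y u v = 0.
  move=> u0 v0 ? ? ? ? h; apply: goursat => // z [/andP[? ?] /andP[? ?]].
  by apply: off; [split; lra|case/or4P: h => h; or4_lra].
have -> : r + d + (r + d) = d + ((r + r) + d) by ring.
rewrite crect_splitx; [|lra..|by line_off line].
rewrite zero ?add0r; [|lra..|or4_lra].
rewrite crect_splitx; [|lra..|by line_off line].
rewrite (zero (_ + _ + _ + _)) ?addr0; [|lra..|or4_lra].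
rewrite crect_splity; [|lra..|by line_off line].
rewrite zero ?add0r; [|lra..|or4_lra].
rewrite crect_splity; [|lra..|by line_off line].
rewrite (zero _ (_ + _ + _ + _)) ?addr0; [|lra..|or4_lra].
rewrite (_ : Re a - (r + d) + d = Re a - r); last by ring.
by rewrite (_ : Im a - (r + d) + d = Im a - r); last ring.
Qed.

End LocalBound.

Section LocalBound.
Context {R : realType}.
Local Notation C := R[i].

(* holo unfolds to a product, and automatic implicit arguments would include
   the hidden binders. *)
Unset Implicit Arguments.

Definition holo (f : C -> C) (z : C) : Prop := derivable (f : C^o -> C^o) z 1.

Lemma holo_cst (k z : C) : holo (fun=> k) z.
Proof. exact: (@derivable_cst C C^o C^o k z 1). Qed.

Lemma holo_id (z : C) : holo (fun w => w) z.
Proof. exact: (@derivable_id C C^o z 1). Qed.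

Lemma holoD {f g z} : holo f z -> holo g z -> holo (fun w => f w + g w) z.
Proof. exact: (@derivableD C C^o C^o f g z 1). Qed.

Lemma holoB {f g z} : holo f z -> holo g z -> holo (fun w => f w - g w) z.
Proof. exact: (@derivableB C C^o C^o f g z 1). Qed.

Lemma holoM {f g z} : holo f z -> holo g z -> holo (fun w => f w * g w) z.
Proof. exact: (@derivableM C C^o f g z 1). Qed.

Lemma holoV {f z} : f z != 0 -> holo f z -> holo (fun w => (f w)^-1) z.
Proof. exact: (@derivableV C C^o f z 1). Qed.

Lemma holoX {f} n {z} : holo f z -> holo (fun w => f w ^+ n) z.
Proof.
move=> hf; elim: n => [|n IH]; first exact: holo_cst.
rewrite (_ : (fun w => _) = (fun w => f w * f w ^+ n)); first exact: holoM.
by apply/funext => w; rewrite exprS.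
Qed.
Lemma holo_subr (a z : C) : holo (fun w => w - a) z.
Proof. exact: (holoB (holo_id z) (holo_cst a z)). Qed.

Lemma holo_inv_subr {a z : C} : z != a -> holo (fun w => (w - a)^-1) z.
Proof.
move=> za; have h : (fun w : C => w - a) z != 0 by rewrite subr_eq0.
have := @holoV (fun w => w - a) z h; apply. exact: holo_subr.
Qed.

Lemma holo_divB {f : C -> C} {a z : C} : z != a -> holo f z ->
  holo (fun w => f w / (w - a)) z.
Proof. by move=> za hf; exact: (holoM hf (holo_inv_subr za)). Qed.

Set Implicit Arguments.

Lemma holo_cdiff f z : holo f z -> cdiff f z.
Proof. exact: derivable_cdiff. Qed.

Lemma contc_inv (a z : C) : z != a -> contc (fun w => (w - a)^-1) z.
Proof. by move=> za; exact: (cdiff_contc (holo_cdiff (holo_inv_subr za))). Qed.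

(** The integral is 2 pi i, but a lower bound suffices and needs no arctangent. Each pair of sides
    contributes to the imaginary part the integral of 2 r / (q^2 + r^2), which is at least 1 / r,
    over a length 2 r. *)
Lemma crect_inv_ge (a : C) r : 0 < r ->
  4 <= normc (crect (fun z => (z - a)^-1) (Re a - r) (Im a - r) (r + r) (r + r)).
Proof.
case: a => ax ay r0; apply: le_trans (ler_Im_normc _).
apply: le_trans (ler_norm _); pose k (z : C) := (z - (ax +i* ay))^-1.
pose H t := k (t +i* (ay - r)) - k (t +i* (ay - r + (r + r))).
pose V t := k ((ax - r + (r + r)) +i* t) - k ((ax - r) +i* t).
have cH t : ax - r <= t <= ax - r + (r + r) -> ccont H t.
  by move=> tI; apply: ccontB; apply: contc_hline; apply: contc_inv;
    rewrite eq_complex /=; apply/negP => /andP[/eqP ? /eqP ?]; lra.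
have cV t : ay - r <= t <= ay - r + (r + r) -> ccont V t.
  by move=> tI; apply: ccontB; apply: contc_vline; apply: contc_inv;
    rewrite eq_complex /=; apply/negP => /andP[/eqP ? /eqP ?]; lra.
rewrite (_ : complex.Im _ =
    \int[lebesgue_measure]_(t in `[ax - r, ax - r + (r + r)]) Im (H t) +
    \int[lebesgue_measure]_(t in `[ay - r, ay - r + (r + r)]) Re (V t)); last first.
  by rewrite /crect /cint /= mul0r mul1r add0r.
have key (q : R) : - r <= q <= r -> 1 / r <= r / (q ^+ 2 + r ^+ 2) + r / (q ^+ 2 + r ^+ 2).
  move=> qr; have p0 : 0 < q ^+ 2 + r ^+ 2 by rewrite ltr_wpDl ?sqr_ge0// exprn_gt0.
  by rewrite -mulrDl ler_pdivrMr// mulrAC ler_pdivlMr//; nra.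
have -> : 4 = 1 / r * (ax - r + (r + r) - (ax - r)) + 1 / r * (ay - r + (r + r) - (ay - r)).
  by field; rewrite gt_eqF.
apply: lerD; apply: Rintegral_itv_lbound; try lra.
- by move=> t /cH /ccont_Im.
- move=> t tI; have := key (t - ax); rewrite /H /= => /(_ _).
  rewrite (_ : ay - r - ay = - r); last by ring.
  rewrite (_ : ay - r + (r + r) - ay = r); last by ring.
  by rewrite sqrrN mulNr opprK => -> //; lra.
- by move=> t /cV /ccont_Re.
- move=> t tI; have := key (t - ay); rewrite /V /=.
  rewrite (_ : ax - r - ax = - r); last by ring.
  rewrite (_ : ax - r + (r + r) - ax = r); last by ring.
  by rewrite sqrrN mulNr opprK (addrC (r ^+ 2)) => -> //; lra.
Qed.

Lemma le_normc_square (a z : C) s : 0 <= s ->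
  [|| Im z == Im a - s, Im z == Im a - s + (s + s), Re z == Re a - s
    | Re z == Re a - s + (s + s)] -> s <= normc (z - a).
Proof.
move=> s0; case/or4P => /eqP e.
- by apply: le_trans (ler_Im_normc _); rewrite ImB ler_normr; apply/orP; right; lra.
- by apply: le_trans (ler_Im_normc _); rewrite ImB ler_normr; apply/orP; left; lra.
- by apply: le_trans (ler_Re_normc _); rewrite ReB ler_normr; apply/orP; right; lra.
- by apply: le_trans (ler_Re_normc _); rewrite ReB ler_normr; apply/orP; left; lra.
Qed.

(* Cauchy's formula on a square with an unspecified constant, at a point where
   f is only assumed continuous; the small squares around a take care of a. *)
Lemma square_local_bound1 (f : C -> C) (a : C) (s M : R) : 0 < s ->
  (forall z, rectangle (Re a - s) (Im a - s) (s + s) (s + s) z -> z != a ->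
     holo f z) ->
  contc f a -> f a = 1 ->
  (forall z, rectangle (Re a - s) (Im a - s) (s + s) (s + s) z ->
     s <= normc (z - a) -> normc (f z) <= M) ->
  1 <= 4 * M.
Proof.
move=> s0 df cf fa1 fM.
have sa : rectangle (Re a - s) (Im a - s) (s + s) (s + s) (Re a +i* (Im a - s)).
  by split => /=; lra.
have M0 : 0 <= M.
  apply: le_trans (normc_ge0 _) (fM _ sa _); apply: le_normc_square; rewrite ?ltW//=.
  by rewrite eqxx.
pose g z := (f z - f a) / (z - a).
have dg z : rectangle (Re a - s) (Im a - s) (s + s) (s + s) z -> z != a -> cdiff g z.
  move=> zr za; apply/holo_cdiff; exact: (holo_divB za (holoB (df z zr za) (holo_cst (f a) z))).
have g0 : crect g (Re a - s) (Im a - s) (s + s) (s + s) = 0.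
  apply: eq0_normc; apply/eqP; rewrite eq_le normc_ge0 andbT.
  apply/ler_addgt0Pr => e e0; rewrite add0r.
  (* On the square of half side [r] the quotient is at most e / 16 / r, and [crect_bound] multiplies
     this by 4 * (4 r). The bound r <= d / 5 keeps the square, of diameter at most 4 r, within
     distance [d] of [a]. *)
  have e16 : 0 < e / 16 by rewrite divr_gt0.
  have [d d0 fd] := cf _ e16.
  pose r := Num.min s (d / 5).
  have r0 : 0 < r by rewrite lt_min s0 divr_gt0.
  have rs : r <= s by rewrite ge_min lexx.
  have rd : r <= d / 5 by rewrite ge_min lexx orbT.
  rewrite (crect_annulus r0 rs dg).
  have := @crect_bound _ g (Re a - r) (Im a - r) (r + r) (r + r) 0 0 (e / 16 / r).
  rewrite (_ : 4 * _ * _ = e); last by field; rewrite gt_eqF.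
  apply; try lra; move=> z zr ze; have rz := le_normc_square (ltW r0) ze.
  have za : z != a.
    by apply: contraTneq rz => ->; rewrite subrr normc0 -ltNge.
  split.
    by apply/cdiff_contc/dg => //; case: zr => ? ?; split; lra.
  rewrite mul0r addr0 subr0 normcM normcV; apply: ler_pM;
    rewrite ?normc_ge0 ?invr_ge0 ?normc_ge0//.
    apply/ltW/fd; apply: le_lt_trans (_ : r + r + (r + r) < d); last by lra.
    by apply: rectangle_diam zr; split; lra.
  by rewrite lef_pV2// posrE// (lt_le_trans r0).
have nz z : rectangle (Re a - s) (Im a - s) (s + s) (s + s) z ->
    [|| Im z == Im a - s, Im z == Im a - s + (s + s), Re z == Re a - s
      | Re z == Re a - s + (s + s)] -> z != a /\ s <= normc (z - a).
  move=> zr /(le_normc_square (ltW s0)) h; split=> //.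
  by apply: contraTneq h => ->; rewrite subrr normc0 -ltNge.
pose q z := f z / (z - a).
have qk : crect q (Re a - s) (Im a - s) (s + s) (s + s) =
    crect (fun z => (z - a)^-1) (Re a - s) (Im a - s) (s + s) (s + s).
  apply/eqP; rewrite -subr_eq0 -crectB ?addr_ge0 ?(ltW s0)//.
    rewrite (_ : (fun z => _) = g) ?g0//.
    by apply/funext => z; rewrite /q /g fa1 mulrBl mul1r.
  move=> z zr /(nz _ zr)[za _]; split; last exact: contc_inv.
  by exact: (cdiff_contc (holo_cdiff (holo_divB za (df z zr za)))).
(* The integral of [q] is at least 4 in norm, and at most 4 * (M / s) * (4 s) = 16 M. *)
have := crect_inv_ge a s0; rewrite -qk => q4.
have := @crect_bound _ q (Re a - s) (Im a - s) (s + s) (s + s) 0 0 (M / s).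
have -> : 4 * (M / s) * (s + s + (s + s)) = 16 * M by field; rewrite gt_eqF.
suff h : normc (crect q (Re a - s) (Im a - s) (s + s) (s + s)) <= 16 * M -> 1 <= 4 * M.
  move=> H; apply/h/H; try lra; move=> z zr ze; have [za sz] := nz z zr ze.
  split; first by exact: (cdiff_contc (holo_cdiff (holo_divB za (df z zr za)))).
  rewrite mul0r addr0 subr0 normcM normcV; apply: ler_pM;
    rewrite ?normc_ge0 ?invr_ge0 ?normc_ge0 ?fM//.
  by rewrite lef_pV2// posrE// (lt_le_trans s0).
by move=> ?; lra.
Qed.

Lemma square_local_bound (f : C -> C) (a : C) (s M : R) : 0 < s ->
  (forall z, rectangle (Re a - s) (Im a - s) (s + s) (s + s) z -> z != a -> holo f z) ->
  contc f a ->
  (forall z, rectangle (Re a - s) (Im a - s) (s + s) (s + s) z ->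
     s <= normc (z - a) -> normc (f z) <= M) ->
  normc (f a) <= 4 * M.
Proof.
move=> s0 df cf fM.
have M0 : 0 <= M.
  apply: le_trans (normc_ge0 (f (Re a +i* (Im a - s)))) (fM _ _ _); first by split => /=; lra.
  by apply: le_normc_square; rewrite ?ltW//= eqxx.
have [->|fa0] := eqVneq (f a) 0; first by rewrite normc0 mulr_ge0.
have nfa0 : 0 < normc (f a).
  by rewrite lt_neqAle normc_ge0 andbT eq_sym; apply: contraNneq fa0 => /eq0_normc ->.
have := @square_local_bound1 (fun z => f z / f a) a s (M / normc (f a)) s0.
rewrite mulrA ler_pdivlMr// mul1r; apply.
- by move=> z zr za; exact: (holoM (df z zr za) (holo_cst _ z)).
- move=> e e0; have [d d0 fd] := cf _ (mulr_gt0 e0 nfa0); exists d => // w /fd.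
  by rewrite -mulrBl normcM normcV ltr_pdivrMr.
- by rewrite divff.
- by move=> z zr sz; rewrite normcM normcV ler_pM2r ?invr_gt0//; exact: fM.
Qed.

End LocalBound.

(** * The maximum principle *)

Section MaximumPrinciple.
Context {R : realType}.
Local Notation C := R[i].

Lemma contcM (f g : C -> C) z : contc f z -> contc g z -> contc (fun w => f w * g w) z.
Proof.
move=> cf cg e e0; pose m := normc (f z) + normc (g z) + 1.
have m0 : 0 < m by rewrite ltr_wpDl// addr_ge0 ?normc_ge0.
pose e' := Num.min 1 (e / m); have e'0 : 0 < e' by rewrite lt_min ltr01 divr_gt0.
have [d1 d10 fd] := cf _ e'0; have [d2 d20 gd] := cg _ e'0.
exists (Num.min d1 d2); first by rewrite lt_min d10.
move=> w; rewrite lt_min => /andP[/fd fe /gd ge].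
have e'1 : e' <= 1 by rewrite ge_min lexx.
have : e' * m <= e by rewrite -ler_pdivlMr// ge_min lexx orbT.
apply: lt_le_trans; rewrite (_ : _ - _ = (f w - f z) * (g w - g z) +
  ((f w - f z) * g z + f z * (g w - g z))); last by ring.
rewrite (le_lt_trans (le_normcD _ _))//.
have := le_normcD ((f w - f z) * g z) (f z * (g w - g z)).
move: fe ge; rewrite !normcM.
move: (normc_ge0 (f w - f z)) (normc_ge0 (g w - g z)) (normc_ge0 (f z)) (normc_ge0 (g z)).
rewrite /m; move: (normc _) (normc (f w - f z)) (normc (g w - g z)) (normc (f z)) (normc (g z)).
move=> t a b p q a0 b0 p0 q0 ae be tpq.
have h1 : a * b <= a by rewrite ler_piMr// ltW// (lt_le_trans be).
have h2 : a * q <= e' * q by rewrite ler_wpM2r// ltW.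
have h3 : p * b <= p * e' by rewrite ler_wpM2l// ltW.
by lra.
Qed.

Lemma contc_cst (k z : C) : contc (fun=> k) z.
Proof. by move=> e e0; exists 1 => // w _; rewrite subrr normc0. Qed.

Lemma normcX (z : C) n : normc (z ^+ n) = normc z ^+ n.
Proof. by elim: n => [|n IH]; rewrite ?expr0 ?normc1// !exprS normcM IH. Qed.

Lemma contc_normc (f : C -> C) (x y : R) : contc f (x +i* y) ->
  {for (x, y), continuous (fun p : R * R => normc (f (p.1 +i* p.2)))}.
Proof.
move=> cf; apply/cvgrPdist_lt => e e0; have [d d0 fd] := cf e e0.
have d20 : 0 < d / 2 by rewrite divr_gt0.
exists ([set x' | `|x - x'| < d / 2], [set y' | `|y - y'| < d / 2]) => /=.
  by split; exists (d / 2).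
move=> [x' y'] /= [x'd y'd]; have /fd : normc ((x' +i* y') - (x +i* y)) < d.
  rewrite (le_lt_trans (ler_normc_ReIm _))//= [d in _ < d]splitr.
  by apply: ltrD; rewrite distrC.
apply: le_lt_trans; rewrite -normcB ler_norml.
have := le_normcD (f (x +i* y) - f (x' +i* y')) (f (x' +i* y')).
have := le_normcD (f (x' +i* y') - f (x +i* y)) (f (x +i* y)).
by rewrite !subrK (normcB (f (x +i* y))); lra.
Qed.

Lemma contcX (f : C -> C) n z : contc f z -> contc (fun w => f w ^+ n) z.
Proof.
move=> cf; elim: n => [|n IH]; first exact: contc_cst.
rewrite (_ : (fun w => _) = (fun w => f w * f w ^+ n)); first exact: contcM.
by apply/funext => w; rewrite exprS.
Qed.

(* Powers of h remove the constant in square_local_bound. *)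
Lemma square_strict_max (h : C -> C) (a : C) (s q : R) : 0 < s -> 0 <= q < 1 ->
  (forall z, rectangle (Re a - s) (Im a - s) (s + s) (s + s) z -> z != a -> holo h z) ->
  contc h a ->
  (forall z, rectangle (Re a - s) (Im a - s) (s + s) (s + s) z ->
     s <= normc (z - a) -> normc (h z) <= q * normc (h a)) ->
  h a = 0.
Proof.
move=> s0 /andP[q0 q1] dh ch hq.
have qq : `|q| < 1 by rewrite ger0_norm.
(* The threshold 1 / 4 beats the constant 4 of [square_local_bound]. *)
have e0 : 0 < 1 / 4 :> R by rewrite divr_gt0.
have [n _ /(_ n (leqnn n))] := (@cvgrPdist_lt _ _ _ _ _ _ _).1 (cvg_expr qq) _ e0.
rewrite sub0r normrN ger0_norm ?exprn_ge0// => qn.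
apply: eq0_normc; apply: contrapT => /eqP ha0.
have ha : 0 < normc (h a) ^+ n by rewrite exprn_gt0// lt_neqAle eq_sym ha0 normc_ge0.
have := @square_local_bound _ (fun z => h z ^+ n) a s (q ^+ n * normc (h a) ^+ n) s0.
move/(_ (fun z zr za => holoX n (dh z zr za)) (contcX n ch)).
rewrite normcX => /(_ _) H; suff : normc (h a) ^+ n <= 4 * (q ^+ n * normc (h a) ^+ n) by nra.
apply: H => z zr sz; rewrite normcX -exprMn; apply: lerXn2r; rewrite ?nnegrE ?normc_ge0//.
  by rewrite mulr_ge0 ?normc_ge0.
exact: hq.
Qed.

(** Serves to choose a square around [a] free of exceptional points other than its centre. *)
Lemma finite_far (S : seq C) (a : C) :
  exists2 d : R, 0 < d & forall z, z \in S -> z != a -> d <= normc (z - a).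
Proof.
elim: S => [|b S [d d0 dS]]; first by exists 1.
have [->|ba] := eqVneq b a.
  exists d => // z; rewrite inE => /predU1P[-> /eqP//|]; exact: dS.
exists (Num.min d (normc (b - a))).
  rewrite lt_min d0 lt_neqAle normc_ge0 andbT eq_sym.
  by apply: contraNneq ba => /eq0_normc/eqP; rewrite subr_eq0.
move=> z; rewrite inE => /predU1P[-> _|zS za]; rewrite ge_min ?lexx ?orbT//.
by rewrite dS.
Qed.

Lemma sqr_normc_ReIm (z : C) : normc z ^+ 2 = Re z ^+ 2 + Im z ^+ 2.
Proof. by case: z => x y /=; rewrite sqr_sqrtr// addr_ge0 ?sqr_ge0. Qed.

Lemma compact_disk (r : R) : compact [set p : R * R | p.1 ^+ 2 + p.2 ^+ 2 <= r].
Proof.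
apply: (@subclosed_compact _ _ (`[- (r + 1), r + 1] `*` `[- (r + 1), r + 1])).
- have cf : continuous (fun p : R * R => p.1 ^+ 2 + p.2 ^+ 2).
    rewrite (_ : (fun p => _) = (fun p : R * R => p.1 * p.1 + p.2 * p.2)).
      by move=> p; apply: cvgD; apply: cvgM; by [exact: cvg_fst|exact: cvg_snd].
    by apply/funext => p; rewrite !expr2.
  exact: (closed_comp (fun p _ => cf p) (@closed_le _ r)).
- by apply: compact_setX; exact: segment_compact.
- by move=> [x y] /= xy; split; rewrite /= in_itv /=; apply/andP; split; nra.
Qed.

(* If a maximizes |g|^2 (1 + eta |z|^2) on a closed disk, then by Cauchy-Schwarz
   it is a strict maximum of |g(z) (1 + eta conj(a) z)|, which contradicts
   square_strict_max unless a lies on the boundary. *)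
Lemma maximum_principle (g : C -> C) (S : seq C) (M : R) :
  (forall z, normc z < 1 -> contc g z) ->
  (forall z, normc z < 1 -> z \notin S -> holo g z) ->
  (forall e, 0 < e -> exists2 r, r < 1 &
     forall z, r <= normc z < 1 -> normc (g z) <= M + e) ->
  forall z, normc z < 1 -> normc (g z) <= M.
Proof.
move=> cg dg gM z0 z01; apply: contrapT => /negP; rewrite -ltNge => gz0.
pose e := (normc (g z0) - M) / 2.
have e0 : 0 < e by rewrite divr_gt0// subr_gt0.
have [r0 r01 gr0] := gM e e0.
(* The closed disk of radius [r] contains [z0], and its boundary lies in the ring where |g| is at
   most M + e. *)
pose r := Num.max (normc z0) (Num.max r0 0).
have r1 : r < 1 by rewrite !gt_max z01 r01 ltr01.
have rr0 : r0 <= r by rewrite !le_max lexx orbT.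
have r_ge0 : 0 <= r by rewrite !le_max lexx !orbT.
have z0r : normc z0 <= r by rewrite le_max lexx.
have Me0 : 0 <= M + e.
  apply: le_trans (normc_ge0 (g r%:C)) (gr0 _ _).
  by rewrite normc_real ger0_norm// rr0.
have Mez0 : M + e < normc (g z0) by rewrite /e; lra.
have [eta eta0 Meta] : exists2 eta, 0 < eta &
    (M + e) ^+ 2 * (1 + eta) < normc (g z0) ^+ 2.
  have h : 0 < normc (g z0) ^+ 2 - (M + e) ^+ 2 by nra.
  pose D := (M + e) ^+ 2 + 1; have D0 : 0 < D by rewrite ltr_wpDl ?sqr_ge0.
  exists ((normc (g z0) ^+ 2 - (M + e) ^+ 2) / D); first by rewrite divr_gt0.
  rewrite mulrDr mulr1 -ltrBrDl mulrA ltr_pdivrMr// mulrC ltr_pM2l// /D.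
  by lra.
pose phi (p : R * R) := normc (g (p.1 +i* p.2)) ^+ 2 * (1 + eta * (p.1 ^+ 2 + p.2 ^+ 2)).
have phiE (z : C) : phi (Re z, Im z) = normc (g z) ^+ 2 * (1 + eta * normc z ^+ 2).
  by rewrite (sqr_normc_ReIm z) /phi; case: z.
pose K := [set p : R * R | p.1 ^+ 2 + p.2 ^+ 2 <= r ^+ 2].
have Kr (z : C) : K (Re z, Im z) <-> normc z <= r.
  rewrite /K /= -sqr_normc_ReIm; split => h; last by apply: lerXn2r; rewrite ?nnegrE ?normc_ge0.
  by rewrite -(@ler_pXn2r _ 2)// nnegrE normc_ge0.
have cphi : {within K, continuous phi}.
  apply: continuous_in_subspaceT => -[x y]; rewrite inE => xyK.
  have xy1 : normc (x +i* y) < 1.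
    by apply: le_lt_trans r1; apply/Kr.
  have c1 := contc_normc (cg _ xy1).
  have c2 : {for (x, y), continuous (fun p : R * R => 1 + eta * (p.1 * p.1 + p.2 * p.2))}.
    apply: cvgD; first exact: cvg_cst.
    by apply: cvgM; [exact: cvg_cst|]; apply: cvgD; apply: cvgM;
      by [exact: cvg_fst|exact: cvg_snd].
  rewrite (_ : phi = fun p : R * R => normc (g (p.1 +i* p.2)) * normc (g (p.1 +i* p.2)) *
      (1 + eta * (p.1 * p.1 + p.2 * p.2))).
    by apply: (cvgM (cvgM c1 c1) c2).
  by apply/funext => p; rewrite /phi !expr2.
have K0 : K !=set0 by exists (0, 0); rewrite /K /= expr0n addr0 sqr_ge0.
have [[ax ay] aK amax] := compact_EVT_max K0 (@compact_disk (r ^+ 2)) cphi.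
rewrite inE in aK; pose a := ax +i* ay.
have ar : normc a <= r by apply/Kr.
have {}amax z : normc z <= r ->
    normc (g z) ^+ 2 * (1 + eta * normc z ^+ 2) <= normc (g a) ^+ 2 * (1 + eta * normc a ^+ 2).
  by rewrite -!phiE => /Kr zK; apply: amax; rewrite inE.
have phia : (M + e) ^+ 2 * (1 + eta) < normc (g a) ^+ 2 * (1 + eta * normc a ^+ 2).
  apply: lt_le_trans (amax _ z0r); apply: lt_le_trans Meta _.
  by rewrite ler_peMr ?sqr_ge0// lerDl mulr_ge0 ?sqr_ge0// ltW.
(* On the circle of radius [r] the weighted function is at most (M + e)^2 (1 + eta), less than its
   value at [z0] by the choice of [eta]. *)
have ar' : normc a < r.
  rewrite lt_neqAle ar andbT; apply: contraTneq phia => ea; rewrite -leNgt.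
  have ga : normc (g a) <= M + e by apply: gr0; rewrite ea rr0.
  have h1 : normc (g a) ^+ 2 <= (M + e) ^+ 2.
    by apply: lerXn2r; rewrite ?nnegrE ?normc_ge0.
  have h2 : 1 + eta * normc a ^+ 2 <= 1 + eta.
    rewrite lerD2l ler_piMr ?(ltW eta0)// exprn_ile1 ?normc_ge0//.
    by rewrite (le_trans ar)// ltW.
  apply: ler_pM h1 h2; first exact: sqr_ge0.
  by rewrite addr_ge0// mulr_ge0 ?sqr_ge0// ltW.
have [d d0 dS] := finite_far S a.
(* Points of the square are within 2 s of [a]; they stay in the disk of radius [r] and avoid [S]
   except possibly at [a]. *)
pose s := Num.min (d / 3) ((r - normc a) / 2).
have s0 : 0 < s by rewrite lt_min !divr_gt0// subr_gt0.
have sr z : rectangle (Re a - s) (Im a - s) (s + s) (s + s) z ->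
    normc z <= r /\ normc (z - a) < d.
  move=> [zx zy]; have za : normc (z - a) <= s + s.
    rewrite (le_trans (ler_normc_ReIm _))// ReB ImB lerD// ler_norml; lra.
  have s1 : s <= d / 3 by rewrite ge_min lexx.
  have s2 : s <= (r - normc a) / 2 by rewrite ge_min lexx orbT.
  split; last lra.
  by have := le_normcD (z - a) a; rewrite subrK; lra.
have sr1 z : rectangle (Re a - s) (Im a - s) (s + s) (s + s) z -> normc z < 1.
  by move=> /sr[zr _]; exact: le_lt_trans r1.
pose h z := g z * (1 + eta%:C * (a^*)%C * z).
pose na := 1 + eta * normc a ^+ 2.
have na1 : 1 <= na by rewrite lerDl mulr_ge0 ?sqr_ge0// ltW.
have haE : normc (h a) = normc (g a) * na.
  rewrite /h normcM; congr (_ * _).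
  rewrite (_ : 1 + _ = na%:C); first by rewrite normc_real ger0_norm// (le_trans ler01).
  rewrite /na; rewrite sqr_normc_ReIm; case: (a) => p q /=.
  by apply/eqP; rewrite eq_complex /=; apply/andP; split; apply/eqP; ring.
(* Cauchy-Schwarz for (1, sqrt eta * a) and (1, sqrt eta * z), with its exact defect. *)
have CS z : normc (1 + eta%:C * (a^*)%C * z) ^+ 2 =
    (1 + eta * normc z ^+ 2) * na - eta * normc (z - a) ^+ 2.
  rewrite /na !sqr_normc_ReIm; case: (z) (a) => x y [p q] /=; ring.
have ga0 : g a != 0.
  apply: contraTneq phia => ->; rewrite normc0 expr0n mul0r -leNgt.
  by rewrite mulr_ge0 ?sqr_ge0// addr_ge0// ltW.
(* At distance at least [s] from [a] the defect is at least eta * s^2, while the product it is taken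
   from is at most (1 + eta)^2. Hence |h|^2 is there at most (1 - t) |h a|^2. *)
pose t := eta * s ^+ 2 / (1 + eta) ^+ 2.
have eta1 : 0 < (1 + eta) ^+ 2 by rewrite exprn_gt0// addr_gt0.
have t0 : 0 < t by rewrite divr_gt0// mulr_gt0// exprn_gt0.
have t1 : t <= 1.
  rewrite ler_pdivrMr// mul1r; have s1 : s < 1.
    by rewrite /s gt_min; apply/orP; right; have := normc_ge0 a; lra.
  have : s ^+ 2 <= 1 by rewrite exprn_ile1// ltW.
  by move: eta0 (sqr_ge0 eta); clear; nra.
pose q := Num.sqrt (1 - t).
suff : h a = 0.
  move=> /(congr1 (@normc R)); rewrite haE normc0 => /eqP; rewrite mulf_eq0.
  case/orP => /eqP; last by move: na1 => /[swap] ->; rewrite ler10.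
  by move=> /eq0_normc /eqP; rewrite (negbTE ga0).
apply: (@square_strict_max h a s q s0).
- rewrite sqrtr_ge0 /= -[ltRHS]sqrtr1 ltr_sqrt ?ltr01//; lra.
- move=> z zr za; apply: holoM.
    apply: dg; first exact: sr1.
    by apply/negP => zS; have := dS z zS za; have [_ +] := sr z zr; lra.
  exact: (holoD (holo_cst 1 z) (holoM (holo_cst (eta%:C * (a^*)%C) z) (holo_id z))).
- apply: contcM; first by apply: cg; exact: le_lt_trans r1.
  apply: cdiff_contc; apply: holo_cdiff.
  exact: (holoD (holo_cst 1 a) (holoM (holo_cst (eta%:C * (a^*)%C) a) (holo_id a))).
- move=> z zr sz; have q0 : 0 <= q by rewrite sqrtr_ge0.
  rewrite -(@ler_pXn2r _ 2)// ?nnegrE ?mulr_ge0 ?normc_ge0//.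
  rewrite exprMn sqr_sqrtr ?subr_ge0// haE normcM !exprMn CS.
  have [zr' _] := sr z zr; have gz := amax z zr'.
  have z2 : normc z ^+ 2 <= 1.
    by rewrite exprn_ile1 ?normc_ge0// (le_trans zr')// ltW.
  have a2 : normc a ^+ 2 <= 1.
    by rewrite exprn_ile1 ?normc_ge0// (le_trans ar)// ltW.
  have s2 : s ^+ 2 <= normc (z - a) ^+ 2.
    by apply: lerXn2r; rewrite ?nnegrE ?normc_ge0 ?(ltW s0).
  have te : t * (1 + eta) ^+ 2 = eta * s ^+ 2 by rewrite /t divfK ?gt_eqF.
  move: gz z2 a2 s2 te; rewrite -/na => gz z2 a2 s2 te.
  have na2 : na <= 1 + eta by rewrite lerD2l ler_piMr// ltW.
  have h1 : 0 <= 1 + eta * normc z ^+ 2 <= 1 + eta.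
    rewrite lerD2l ler_piMr ?(ltW eta0)// andbT.
    by rewrite addr_ge0// mulr_ge0 ?sqr_ge0// ltW.
  have h2 : (1 + eta * normc z ^+ 2) * na <= (1 + eta) ^+ 2.
    by rewrite expr2; case/andP: h1 => ? ?; apply: ler_pM => //; lra.
  have h3 : t * ((1 + eta * normc z ^+ 2) * na) <= eta * normc (z - a) ^+ 2.
    apply: le_trans (_ : eta * s ^+ 2 <= _); last by rewrite ler_pM2l.
    by rewrite -te ler_pM2l.
  have na0 : 0 <= na by lra.
  apply: le_trans (_ : normc (g z) ^+ 2 * ((1 - t) * ((1 + eta * normc z ^+ 2) * na)) <= _).
    by rewrite ler_wpM2l ?sqr_ge0//; lra.
  rewrite [leLHS](_ : _ = (1 - t) * (normc (g z) ^+ 2 * (1 + eta * normc z ^+ 2) * na)); last by ring.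
  by rewrite ler_wpM2l ?subr_ge0// (expr2 na) [leRHS]mulrA ler_wpM2r.
Qed.

End MaximumPrinciple.

(** * The scalar conditions *)

Section Inequality.
Context {R : realType}.
Local Notation C := R[i].

Definition sqc (z : C) : R := Re z ^+ 2 + Im z ^+ 2.

Lemma sqc_ge0 z : 0 <= sqc z.
Proof. by rewrite addr_ge0 ?sqr_ge0. Qed.

Lemma sqcM z w : sqc (z * w) = sqc z * sqc w.
Proof. by case: z w => x y [p q]; rewrite /sqc /=; ring. Qed.

Lemma sqcR (x : R) : sqc x%:C = x ^+ 2.
Proof. by rewrite /sqc /= expr0n addr0. Qed.

Lemma sqcN z : sqc (- z) = sqc z.
Proof. by case: z => x y; rewrite /sqc /= !sqrrN. Qed.

(** The difference of the two sides is |t z - w|^2 / t. A small [t] keeps the weight of the main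
    term near 1 at the expense of the error term. *)
Lemma sqcD_young (t : R) z w : 0 < t -> sqc (z + w) <= (1 + t) * sqc z + (1 + t^-1) * sqc w.
Proof.
case: z w => x y [p q] t0; rewrite /sqc /= -subr_ge0.
rewrite (_ : _ - _ = ((t * x - p) ^+ 2 + (t * y - q) ^+ 2) / t).
  by rewrite divr_ge0 ?(ltW t0)// addr_ge0 ?sqr_ge0.
by field; rewrite gt_eqF.
Qed.

Lemma sqcD z w : sqc (z + w) <= 2 * sqc z + 2 * sqc w.
Proof. by have := sqcD_young z w ltr01; rewrite invr1. Qed.

Lemma sqc_CS a b z w : sqc (a * z + b * w) <= (sqc a + sqc b) * (sqc z + sqc w).
Proof.
case: a b z w => a1 a2 [b1 b2] [x y] [p q]; rewrite /sqc /= -subr_ge0.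
rewrite (_ : _ - _ = (a1 * p + a2 * q - b1 * x - b2 * y) ^+ 2 +
  (a1 * q - a2 * p - b1 * y + b2 * x) ^+ 2); first by rewrite addr_ge0 ?sqr_ge0.
ring.
Qed.

(* If |k| >= 30 s^2 the two relations make u4 and w4 negligible; otherwise a is
   negligible and b * u3, b * w3 are close to l * u4, l * w4 with l = k / s^2. *)
Lemma pencil_inequality (a b k xi eta u2 u3 u4 w2 w3 w4 : C) (r s : R) :
  r = 1 / 100 -> s = 1 / 1000 -> sqc a + sqc b = 1 -> k = a + b * s%:C ->
  k * u4 = b * (s ^+ 2)%:C * u3 + (k * (s ^+ 2 + r ^+ 2)%:C - b * (s ^+ 3)%:C) * u2
    - (r ^+ 2 * s ^+ 2)%:C * xi ->
  k * w4 = b * (s ^+ 2)%:C * w3 + (k * (s ^+ 2 + r ^+ 2)%:C - b * (s ^+ 3)%:C) * w2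
    - (r ^+ 2 * s ^+ 2)%:C * eta ->
  sqc (a * u2 + b * u3) + sqc (a * (u3 + w2) + b * (u4 + w3)) + sqc u4 + sqc w4 <=
  23 / 10 * (sqc u2 + sqc u3 + sqc u4 + sqc w2 + sqc w3 + sqc w4 + sqc xi + sqc eta).
Proof.
move=> rE sE ab kE ku kw.
have A0 := sqc_ge0 a; have B0 := sqc_ge0 b.
have bound (y2 y3 y4 z : C) :
    k * y4 = b * (s ^+ 2)%:C * y3 + (k * (s ^+ 2 + r ^+ 2)%:C - b * (s ^+ 3)%:C) * y2
      - (r ^+ 2 * s ^+ 2)%:C * z ->
    sqc k * sqc y4 <= 4 * (s ^+ 4 * sqc y3) + 4 * (s ^+ 6 * sqc y2) +
      4 * (sqc k * (s ^+ 2 + r ^+ 2) ^+ 2 * sqc y2) + 4 * (r ^+ 4 * s ^+ 4 * sqc z).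
  rewrite -sqcM => ->.
  rewrite (_ : _ - _ = (b * (s ^+ 2)%:C * y3 + - (b * (s ^+ 3)%:C * y2)) +
    (k * (s ^+ 2 + r ^+ 2)%:C * y2 + - ((r ^+ 2 * s ^+ 2)%:C * z))); last by ring.
  have h1 := sqcD (b * (s ^+ 2)%:C * y3 + - (b * (s ^+ 3)%:C * y2))
    (k * (s ^+ 2 + r ^+ 2)%:C * y2 + - ((r ^+ 2 * s ^+ 2)%:C * z)).
  have h2 := sqcD (b * (s ^+ 2)%:C * y3) (- (b * (s ^+ 3)%:C * y2)).
  have h3 := sqcD (k * (s ^+ 2 + r ^+ 2)%:C * y2) (- ((r ^+ 2 * s ^+ 2)%:C * z)).
  move: h2 h3; rewrite !sqcN !sqcM !sqcR => h2 h3.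
  have b1 : sqc b <= 1 by lra.
  have h4 : sqc b * (s ^+ 2) ^+ 2 * sqc y3 <= s ^+ 4 * sqc y3.
    by rewrite -exprM ler_wpM2r ?sqc_ge0// ler_piMl// exprn_even_ge0.
  have h5 : sqc b * (s ^+ 3) ^+ 2 * sqc y2 <= s ^+ 6 * sqc y2.
    by rewrite -exprM ler_wpM2r ?sqc_ge0// ler_piMl// exprn_even_ge0.
  have h6 : (r ^+ 2 * s ^+ 2) ^+ 2 * sqc z = r ^+ 4 * s ^+ 4 * sqc z by rewrite exprMn -!exprM.
  by lra.
have [kL|kL] := leP (900 * s ^+ 4) (sqc k).
  have small (y2 y3 y4 z : C) :
      sqc k * sqc y4 <= 4 * (s ^+ 4 * sqc y3) + 4 * (s ^+ 6 * sqc y2) +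
        4 * (sqc k * (s ^+ 2 + r ^+ 2) ^+ 2 * sqc y2) + 4 * (r ^+ 4 * s ^+ 4 * sqc z) ->
      sqc y4 <= 1 / 200 * (sqc y2 + sqc y3 + sqc z).
    have s0 : 0 < s by lra.
    have s4 : 0 < s ^+ 4 by exact: exprn_gt0.
    have k0 : 0 < sqc k by apply: lt_le_trans kL; lra.
    move=> h; rewrite -(ler_pM2l k0) (le_trans h)//.
    have := sqc_ge0 y2; have := sqc_ge0 y3; have := sqc_ge0 z.
    have m900 : s ^+ 4 <= sqc k / 900 by lra.
    move=> Z0 Y30 Y20.
    have := ler_wpM2r Z0 m900; have := ler_wpM2r Y30 m900; have := ler_wpM2r Y20 m900.
    have -> : s ^+ 6 = s ^+ 4 * (1 / 1000 / 1000) by rewrite sE; field.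
    have -> : (s ^+ 2 + r ^+ 2) ^+ 2 = (101 / 1000 / 1000) ^+ 2 by rewrite sE rE; field.
    have -> : r ^+ 4 = 1 / 100 / 100 / 100 / 100 by rewrite rE; field.
    rewrite -!mulrA; move: (sqc k) (s ^+ 4) (sqc y2) (sqc y3) (sqc z) Z0 Y30 Y20 k0; clear.
    move=> K m Y2 Y3 Z Z0 Y30 Y20 k0.
    have := mulr_ge0 (ltW k0) Z0; have := mulr_ge0 (ltW k0) Y20.
    by have := mulr_ge0 (ltW k0) Y30; lra.
  have U4 := small _ _ _ _ (bound _ _ _ _ ku); have W4 := small _ _ _ _ (bound _ _ _ _ kw).
  (* Without [b * u4] the two squares cost a factor 2, as |a|^2 + |b|^2 = 1. Splitting it off with t
     = 1 / 15 turns this into 32 / 15 and gives |u4|^2 the weight 16, which the bound 1 / 200 makes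
     harmless. *)
  have t0 : 0 < 1 / 15 :> R by lra.
  have := sqcD_young (a * u3 + (a * w2 + b * w3)) (b * u4) t0.
  rewrite (_ : _ + b * u4 = a * (u3 + w2) + b * (u4 + w3)); last by ring.
  have := sqcD (a * u3) (a * w2 + b * w3); have := sqc_CS a b w2 w3.
  have := sqcD (a * u2) (b * u3); rewrite !sqcM ab invf_div.
  have : sqc b * sqc u4 <= sqc u4 by rewrite ler_piMl ?sqc_ge0//; lra.
  have : sqc a * sqc u2 <= sqc u2 by rewrite ler_piMl ?sqc_ge0//; lra.
  have : sqc a * sqc u3 + sqc b * sqc u3 = sqc u3 by rewrite -mulrDl ab mul1r.
  have := mulr_ge0 A0 (sqc_ge0 u3); have := mulr_ge0 B0 (sqc_ge0 u3).
  have := sqc_ge0 u2; have := sqc_ge0 u3; have := sqc_ge0 w2; have := sqc_ge0 w3.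
  have := sqc_ge0 xi; have := sqc_ge0 eta.
  by move: (sqc_ge0 w4) U4 W4; clear; lra.
have s0 : 0 < s by lra.
have s2 : (s ^+ 2)%:C != 0.
  by rewrite -(rmorph0 (real_complex R)) (inj_eq (@complexI R)) expf_neq0// gt_eqF.
have [l kl] : exists l, k = l * (s ^+ 2)%:C by exists (k / (s ^+ 2)%:C); rewrite divfK.
have l900 : sqc l <= 900.
  have s4 : 0 < s ^+ 4 by exact: exprn_gt0.
  rewrite -(ler_pM2r s4); apply: le_trans (ltW kL).
  by rewrite kl sqcM sqcR -exprM.
have error (y2 y3 y4 z : C) :
    k * y4 = b * (s ^+ 2)%:C * y3 + (k * (s ^+ 2 + r ^+ 2)%:C - b * (s ^+ 3)%:C) * y2
      - (r ^+ 2 * s ^+ 2)%:C * z ->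
    exists2 e, b * y3 = l * y4 + e & sqc e <= 1 / 1000 * (sqc y2 + sqc z).
  move=> h; exists (- ((l * (s ^+ 2 + r ^+ 2)%:C + - (b * s%:C)) * y2) + (r ^+ 2)%:C * z).
    apply: (mulfI s2); rewrite [LHS](_ : _ = b * (s ^+ 2)%:C * y3); last by ring.
    have -> : b * (s ^+ 2)%:C * y3 = k * y4 -
        ((k * (s ^+ 2 + r ^+ 2)%:C - b * (s ^+ 3)%:C) * y2 - (r ^+ 2 * s ^+ 2)%:C * z).
      by rewrite h; ring.
    rewrite (_ : (r ^+ 2 * s ^+ 2)%:C = (r ^+ 2)%:C * (s ^+ 2)%:C); last by rewrite rmorphM.
    rewrite (_ : (s ^+ 3)%:C = s%:C * (s ^+ 2)%:C); last by rewrite -rmorphM.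
    by rewrite {1 2}kl; ring.
  have h1 := sqcD (- ((l * (s ^+ 2 + r ^+ 2)%:C + - (b * s%:C)) * y2)) ((r ^+ 2)%:C * z).
  have h2 := sqcD (l * (s ^+ 2 + r ^+ 2)%:C) (- (b * s%:C)).
  have h3 := ler_wpM2r (sqc_ge0 y2) h2.
  move: h1 h3; rewrite !sqcN !sqcM !sqcR.
  have -> : s ^+ 2 = 1 / 1000 * (1 / 1000) by rewrite sE; field.
  have -> : r ^+ 2 = 1 / 100 * (1 / 100) by rewrite rE; field.
  have h4 := ler_wpM2r (sqc_ge0 y2) l900.
  have b1 : sqc b <= 1 by lra.
  have h5 := ler_wpM2r (sqc_ge0 y2) b1.
  have := sqc_ge0 y2; have := sqc_ge0 z; have := mulr_ge0 B0 (sqc_ge0 y2).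
  move: h4 h5; move: (sqc l) (sqc y2) (sqc z) (sqc b) (sqc (_ + _)); clear.
  by move=> L Y2 Z B E; lra.
have [eu buE eu_le] := error _ _ _ _ ku; have [ew bwE ew_le] := error _ _ _ _ kw.
(* Both [k] and [b * s] are small, the former of order 30 s^2. *)
have a_le : sqc a <= 1 / 1000 * (1 / 200).
  have -> : a = k + - (b * s%:C) by rewrite kE; ring.
  have := sqcD k (- (b * s%:C)); rewrite sqcN sqcM sqcR.
  have b1 : sqc b <= 1 by lra.
  have := ler_wpM2r (sqr_ge0 s) b1; move: kL.
  have -> : s ^+ 4 = 1 / 1000 * (1 / 1000) * (1 / 1000) * (1 / 1000) by rewrite sE; field.
  have -> : s ^+ 2 = 1 / 1000 * (1 / 1000) by rewrite sE; field.
  by lra.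
have b1 : sqc b <= 1 by lra.
have t0 : 0 < 1 / 20 :> R by lra.
have T1 := sqcD_young (b * u3) (a * u2) t0.
have T2 := sqcD_young (b * u4 + l * w4) (ew + a * (u3 + w2)) t0.
have T2' := sqcD ew (a * (u3 + w2)); have T2'' := sqcD u3 w2.
(* This brings in |l u4|^2 and |l w4|^2, which the relations convert back into |b u3|^2 and |b w3|^2
   up to small errors. The resulting constant is 2 up to the Young weights, hence below 23 / 10. *)
have CS := sqc_CS b l u4 w4.
have lu : sqc l * sqc u4 <= (1 + 1 / 20) * sqc (b * u3) + (1 + (1 / 20)^-1) * sqc eu.
  rewrite -sqcM (_ : l * u4 = b * u3 + - eu); last by rewrite buE addrK.
  by rewrite -(sqcN eu); exact: sqcD_young.
have lw : sqc l * sqc w4 <= (1 + 1 / 20) * sqc (b * w3) + (1 + (1 / 20)^-1) * sqc ew.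
  rewrite -sqcM (_ : l * w4 = b * w3 + - ew); last by rewrite bwE addrK.
  by rewrite -(sqcN ew); exact: sqcD_young.
move: T1 T2; rewrite (addrC (b * u3)).
rewrite (_ : _ + _ + (ew + _) = a * (u3 + w2) + b * (u4 + w3)); last first.
  by rewrite [b * (u4 + w3)]mulrDr bwE; ring.
move: T2' CS lu lw; rewrite !sqcM invf_div.
have := ler_wpM2r (sqc_ge0 u2) a_le; have := ler_wpM2r (sqc_ge0 (u3 + w2)) a_le.
have := ler_wpM2r (sqc_ge0 u3) b1; have := ler_wpM2r (sqc_ge0 w3) b1.
have := ler_wpM2r (sqc_ge0 u4) b1; have := ler_wpM2r (sqc_ge0 w4) b1.
have := sqc_ge0 u2; have := sqc_ge0 u3; have := sqc_ge0 u4.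
have := sqc_ge0 w2; have := sqc_ge0 w3; have := sqc_ge0 w4.
have := sqc_ge0 xi; have := sqc_ge0 eta.
by move: T2'' eu_le ew_le; clear; lra.
Qed.
End Inequality.

(** * The Szego kernel at three real nodes *)

Section SzegoForm.
Context {R : realType}.
Local Notation C := R[i].

Lemma conjCc (z : C) : Num.conj z = conjc z.
Proof. by []. Qed.

Lemma sqcE (z : C) : (sqc z)%:C = conjc z * z.
Proof.
case: z => x y; rewrite /sqc /=; apply/eqP; rewrite eq_complex /=.
by apply/andP; split; apply/eqP; ring.
Qed.

Context (p : 'I_3 -> R) (p1 : forall i, `|p i| < 1).

Lemma szego_neq0 i j : 1 - p i * p j != 0.
Proof.
rewrite subr_eq0 eq_sym lt_eqF//; apply: le_lt_trans (ler_norm _) _.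
rewrite normrM; have := p1 i; have := p1 j.
by have := normr_ge0 (p i); have := normr_ge0 (p j); nra.
Qed.

Definition blaschke (k i : 'I_3) : R := (p i - p k) / (1 - p k * p i).

(* Takenaka-Malmquist functions of the three nodes, evaluated at the nodes. *)
Definition malmquist (k i : 'I_3) : R :=
  (\prod_(l < 3 | (l < k)%N) blaschke l i) / (1 - p k * p i).

(** The terms telescope to 1 minus the product of the full Blaschke products at the two nodes, over
    1 - p i * p j; the full Blaschke product vanishes at every node. *)
Lemma szego_malmquist i j :
  (1 - p i * p j)^-1 = \sum_k (1 - p k ^+ 2) * malmquist k i * malmquist k j.
Proof.
have tele k : (1 - p k ^+ 2) / (1 - p k * p i) / (1 - p k * p j) =
    (1 - blaschke k i * blaschke k j) / (1 - p i * p j).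
  by rewrite /blaschke; field; rewrite !szego_neq0.
have B0 : (\prod_k blaschke k i) = 0.
  by rewrite (bigD1 i)//= /blaschke subrr !mul0r.
have prods k : [/\ \prod_(l < 3 | (l < @ord0 2)%N) blaschke l k = 1,
    \prod_(l < 3 | (l < lift (@ord0 2) ord0)%N) blaschke l k = blaschke ord0 k &
    \prod_(l < 3 | (l < lift (@ord0 2) (lift ord0 ord0))%N) blaschke l k =
      blaschke ord0 k * blaschke (lift ord0 ord0) k].
  by split; rewrite big_mkcond !big_ord_recl big_ord0 /= ?mulr1.
transitivity ((1 - (\prod_k blaschke k i) * (\prod_k blaschke k j)) / (1 - p i * p j)).
  by rewrite B0 mul0r subr0 mul1r.
rewrite !big_ord_recl !big_ord0 /malmquist addr0 !mulr1.
have [-> -> ->] := prods i; have [-> -> ->] := prods j.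
have t0 := tele ord0; have t1 := tele (lift ord0 ord0); have t2 := tele (lift ord0 (lift ord0 ord0)).
set a0 := blaschke _ i in t0 *; set a1 := blaschke _ i in t1 *; set a2 := blaschke _ i in t2 *.
set b0 := blaschke _ j in t0 *; set b1 := blaschke _ j in t1 *; set b2 := blaschke _ j in t2 *.
transitivity ((1 - a0 * b0) / (1 - p i * p j) + a0 * b0 * ((1 - a1 * b1) / (1 - p i * p j)) +
  a0 * b0 * a1 * b1 * ((1 - a2 * b2) / (1 - p i * p j))); first by ring.
by rewrite -t0 -t1 -t2; ring.
Qed.

(** The quadratic form of the matrix (p i p j)^m / (1 - p i p j), as [szego_formE] shows, written as
    a weighted sum of squares so that it is visibly real and nonnegative. *)
Definition szego_form (m : nat) (y : 'I_3 -> C) : R :=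
  \sum_k (1 - p k ^+ 2) * sqc (\sum_i (malmquist k i * p i ^+ m)%:C * y i).

Definition moment (m : nat) (y : 'I_3 -> C) : C := \sum_i (p i ^+ m)%:C * y i.

Lemma szego_form_ge0 m y : 0 <= szego_form m y.
Proof.
apply: sumr_ge0 => k _; rewrite mulr_ge0 ?sqc_ge0// subr_ge0.
by rewrite -[leLHS]real_normK ?num_real// exprn_ile1// ltW.
Qed.

Lemma sqc_sum (c : 'I_3 -> R) (y : 'I_3 -> C) :
  (sqc (\sum_i (c i)%:C * y i))%:C = \sum_i \sum_j (c i * c j)%:C * (conjc (y i) * y j).
Proof.
rewrite sqcE rmorph_sum /= big_distrl /=; apply: eq_bigr => i _.
rewrite big_distrr /=; apply: eq_bigr => j _.
by rewrite rmorphM /= oppr0 -/(c i)%:C rmorphM /=; ring.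
Qed.

Lemma szego_formE m y : (szego_form m y)%:C =
  \sum_i \sum_j ((p i * p j) ^+ m / (1 - p i * p j))%:C * (conjc (y i) * y j).
Proof.
rewrite /szego_form rmorph_sum /=.
under eq_bigr => k _ do rewrite rmorphM /= sqc_sum big_distrr /=.
rewrite exchange_big /=; apply: eq_bigr => i _.
under eq_bigr => k _ do rewrite big_distrr /=.
rewrite exchange_big /=; apply: eq_bigr => j _.
rewrite szego_malmquist mulr_sumr rmorph_sum mulr_suml; apply: eq_bigr => k _.
rewrite exprMn (_ : p i ^+ m * _ * _ = (1 - p k ^+ 2) *
  (malmquist k i * p i ^+ m * (malmquist k j * p j ^+ m))); last by ring.
rewrite [LHS]mulrA; congr (_ * _); exact: (esym (rmorphM (real_complex R) _ _)).
Qed.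

(** With x = p i * p j this is x^m / (1 - x) = x^m + x^(m+1) / (1 - x), where x^m is the rank one
    matrix of the moment. *)
Lemma szego_form_step m y : szego_form m y = sqc (moment m y) + szego_form m.+1 y.
Proof.
apply: (@complexI R); rewrite rmorphD /= !szego_formE sqc_sum -big_split /=.
apply: eq_bigr => i _; rewrite -big_split /=; apply: eq_bigr => j _.
rewrite -mulrDl; congr (_ * _); rewrite -rmorphD; congr (_%:C).
by rewrite exprS -exprMn; field; rewrite szego_neq0.
Qed.

Lemma szego_form_shift m k y :
  szego_form m (fun i => (p i ^+ k)%:C * y i) = szego_form (k + m) y.
Proof.
apply: eq_bigr => l _; congr (_ * sqc _); apply: eq_bigr => i _.
by rewrite exprD mulrCA !mulrA -!rmorphM /=; congr (_%:C * _); ring.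
Qed.

Lemma szego_formZ m (c : R) y : szego_form m (fun i => c%:C * y i) = c ^+ 2 * szego_form m y.
Proof.
rewrite /szego_form big_distrr /=; apply: eq_bigr => k _.
rewrite mulrCA -(sqcR c) -sqcM big_distrr /=; congr (_ * sqc _).
by apply: eq_bigr => i _; rewrite mulrCA.
Qed.

Lemma szego_formD_young m (t : R) y y' : 0 < t ->
  szego_form m (fun i => y i + y' i) <= (1 + t) * szego_form m y + (1 + t^-1) * szego_form m y'.
Proof.
move=> t0; rewrite /szego_form !big_distrr -big_split /=; apply: ler_sum => k _.
rewrite mulrCA [X in _ <= _ + X]mulrCA -mulrDr ler_wpM2l//.
  rewrite subr_ge0 -[leLHS]real_normK ?num_real// exprn_ile1// ltW//; exact: p1.
apply: le_trans (sqcD_young _ _ t0); rewrite -big_split /= le_eqVlt; apply/orP; left.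
by apply/eqP; congr sqc; apply: eq_bigr => i _; rewrite mulrDr.
Qed.

End SzegoForm.

(** * Contractivity with respect to the scalar kernels *)

Section Positivity.
Context {R : realType}.
Local Notation C := R[i].

Definition node (i : 'I_3) : R := nth 0 [:: 1 / 100; - (1 / 100); 1 / 1000] i.

(** The nodes are the roots of (x^2 - (1/100)^2)(x - 1/1000). Hence moments obey a three-term
    recurrence with small coefficients. *)
Lemma node_cubic i : node i ^+ 3 =
  1 / 1000 * node i ^+ 2 + (1 / 100) ^+ 2 * node i - (1 / 100) ^+ 2 * (1 / 1000).
Proof. by case: i => -[|[|[|//]]] ?; rewrite /node /=; field. Qed.

Lemma ltr_norm_node i : `|node i| < 1.
Proof. by case: i => -[|[|[|//]]] ?; rewrite /node /= ltr_norml; lra. Qed.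

(** Multiplication by z^k at the nodes; up to the constant c, the adjoints of the matrices [W_i]
    send (u, w) to ([dil 2 u], [dil 3 u + dil 2 w]). *)
Definition dil (k : nat) (y : 'I_3 -> C) (i : 'I_3) : C := (node i ^+ k)%:C * y i.

Lemma moment_dil m k y : moment node m (dil k y) = moment node (k + m) y.
Proof. by apply: eq_bigr => i _; rewrite /dil exprD mulrCA mulrA -rmorphM. Qed.

Lemma momentD m y y' :
  moment node m (fun i => y i + y' i) = moment node m y + moment node m y'.
Proof. by rewrite -big_split; apply: eq_bigr => i _; rewrite mulrDr. Qed.

Lemma moment_cubic m y : moment node m.+3 y =
  (1 / 1000)%:C * moment node m.+2 y + ((1 / 100) ^+ 2)%:C * moment node m.+1 y
  - ((1 / 100) ^+ 2 * (1 / 1000))%:C * moment node m y.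
Proof.
rewrite !big_distrr -sumrN -!big_split /=; apply: eq_bigr => i _.
rewrite !mulrA -!rmorphM -mulNr -rmorphN -!mulrDl -!rmorphD /=; congr (_%:C * _).
rewrite -[m.+3]addn3 -[m.+2]addn2 -[m.+1]addn1 !exprD node_cubic expr1; ring.
Qed.

Definition kernel_form (a b : C) (y : 'I_3 -> C) : R :=
  sqc (a * moment node 0 y + b * moment node 1 y) + szego_form node 2 y.

(** By [node_cubic] the form of order 5 is bounded by small multiples of those of orders 4, 3 and 2.
    These unfold into moments plus the form of order 5 itself, which is absorbed on the left. *)
Lemma szego_tail y : szego_form node 5 y <= 1 / 1000 * (1 / 100) *
  (sqc (moment node 2 y) + sqc (moment node 3 y) + sqc (moment node 4 y)).
Proof.
have pos m : 0 <= szego_form node m y by apply: szego_form_ge0; exact: ltr_norm_node.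
have step m := szego_form_step ltr_norm_node m y.
have e5 : szego_form node 5 y = szego_form node 2
    (fun i => ((1 / 1000)%:C * dil 2 y i + ((1 / 100) ^+ 2)%:C * dil 1 y i) +
      (- ((1 / 100) ^+ 2 * (1 / 1000)))%:C * y i).
  rewrite -(szego_form_shift _ 2 3); congr szego_form; apply/funext => i.
  rewrite node_cubic /dil !mulrA -!rmorphM -!mulrDl -!rmorphD /=.
  by congr (_%:C * _); rewrite expr1; ring.
have h1 := szego_formD_young ltr_norm_node 2
  (fun i => (1 / 1000)%:C * dil 2 y i + ((1 / 100) ^+ 2)%:C * dil 1 y i)
  (fun i => (- ((1 / 100) ^+ 2 * (1 / 1000)))%:C * y i) (@ltr01 R).
have h2 := szego_formD_young ltr_norm_node 2
  (fun i => (1 / 1000)%:C * dil 2 y i)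
  (fun i => ((1 / 100) ^+ 2)%:C * dil 1 y i) (@ltr01 R).
move: h1 h2; rewrite !szego_formZ !szego_form_shift invr1 => h1 h2.
have := pos 2%N; have := pos 3%N; have := pos 4%N; have := pos 5%N.
have := step 2%N; have := step 3%N; have := step 4%N.
have := sqc_ge0 (moment node 2 y); have := sqc_ge0 (moment node 3 y).
have := sqc_ge0 (moment node 4 y).
by move: e5 h1 h2; rewrite (_ : (2 + 2 = 4)%N) // (_ : (1 + 2 = 3)%N) //; clear; lra.
Qed.

(** The recurrence eliminates the moments of orders 0 and 1 in favour of their combination in the
    kernel form; this is the relation that [pencil_inequality] takes as hypothesis. *)
Lemma relation_of_moments a b y (k : C) : k = a + b * (1 / 1000)%:C ->
  k * moment node 4 y = b * ((1 / 1000) ^+ 2)%:C * moment node 3 y +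
    (k * ((1 / 1000) ^+ 2 + (1 / 100) ^+ 2)%:C - b * ((1 / 1000) ^+ 3)%:C) * moment node 2 y
    - ((1 / 100) ^+ 2 * (1 / 1000) ^+ 2)%:C * (a * moment node 0 y + b * moment node 1 y).
Proof.
move=> ->; rewrite (moment_cubic 1) (moment_cubic 0).
rewrite !rmorphM !rmorphD !rmorphXn /=; ring.
Qed.

(** Since (13/20)^2 * 23/10 < 0.972, [pencil_inequality] leaves a margin. It covers the Young weight
    1 / 50, which separates [dil 2 w] from [dil 3 u], and the tails of order 5. *)
Lemma kernel_form_contractive (a b : C) (u w : 'I_3 -> C) (c2 : R) :
  sqc a + sqc b = 1 -> c2 = (13 / 20) ^+ 2 ->
  0 <= kernel_form a b u + kernel_form a b w -
    c2 * (kernel_form a b (dil 2 u) + kernel_form a b (fun i => dil 3 u i + dil 2 w i)).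
Proof.
move=> ab c2E; rewrite /kernel_form !momentD !moment_dil.
have hmain := @pencil_inequality R a b _ (a * moment node 0 u + b * moment node 1 u)
  (a * moment node 0 w + b * moment node 1 w) (moment node 2 u) (moment node 3 u)
  (moment node 4 u) (moment node 2 w) (moment node 3 w) (moment node 4 w) _ _ erefl erefl
  ab erefl (relation_of_moments u erefl) (relation_of_moments w erefl).
have t0 : 0 < 1 / 50 :> R by lra.
have hD := szego_formD_young ltr_norm_node 2 (dil 2 w) (dil 3 u) t0.
move: hD; rewrite (_ : (fun i => _) = (fun i => dil 3 u i + dil 2 w i)); last first.
  by apply/funext => i; rewrite addrC.
rewrite !szego_form_shift invf_div.
have tu := szego_tail u; have tw := szego_tail w.
have step y m := szego_form_step ltr_norm_node m y.
have pos y m : 0 <= szego_form node m y by apply: szego_form_ge0; exact: ltr_norm_node.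
have := step u 2%N; have := step u 3%N; have := step u 4%N.
have := step w 2%N; have := step w 3%N; have := step w 4%N.
have := pos u 5%N; have := pos w 5%N.
have := sqc_ge0 (moment node 2 u); have := sqc_ge0 (moment node 3 u).
have := sqc_ge0 (moment node 4 u); have := sqc_ge0 (moment node 2 w).
have := sqc_ge0 (moment node 3 w); have := sqc_ge0 (moment node 4 w).
have := sqc_ge0 (a * moment node 0 u + b * moment node 1 u).
have := sqc_ge0 (a * moment node 0 w + b * moment node 1 w).
move: hmain tu tw; rewrite c2E (_ : (2 + 0 = 2)%N) // (_ : (2 + 1 = 3)%N) // (_ : (3 + 0 = 3)%N) //.
rewrite (_ : (3 + 1 = 4)%N) // (_ : (2 + 2 = 4)%N) // (_ : (3 + 2 = 5)%N) //; clear.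
by lra.
Qed.

End Positivity.

(** * Positivity of the block Pick matrix *)

Section PickMatrix.
Local Open Scope sesquilinear_scope.
Context {R : realType}.
Local Notation C := R[i].

Definition target (c x : R) : 'M[C]_2 :=
  (c * x ^+ 2)%:C%:M + (c * x ^+ 3)%:C *: delta_mx ord0 ord_max.

Lemma target_entries c x : [/\ target c x ord0 ord0 = (c * x ^+ 2)%:C,
  target c x ord0 ord_max = (c * x ^+ 3)%:C, target c x ord_max ord0 = 0 &
  target c x ord_max ord_max = (c * x ^+ 2)%:C].
Proof.
by split; rewrite !mxE /= ?mulr1n ?mulr0n ?mulr1 ?mulr0 ?addr0 ?add0r.
Qed.

Lemma sum_ord2 (F : 'I_2 -> C) : \sum_i F i = F ord0 + F ord_max.
Proof.
rewrite big_ord_recl big_ord1; congr (_ + F _); exact: val_inj.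
Qed.

Lemma conjcD (z t : C) : conjc (z + t) = conjc z + conjc t.
Proof. exact: rmorphD. Qed.

Lemma conjcM (z t : C) : conjc (z * t) = conjc z * conjc t.
Proof. exact: rmorphM. Qed.

Lemma realcM (z t : R) : (z * t)%:C = z%:C * t%:C.
Proof. exact: rmorphM. Qed.

Lemma realcD (z t : R) : (z + t)%:C = z%:C + t%:C.
Proof. exact: rmorphD. Qed.

Lemma realcB (z t : R) : (z - t)%:C = z%:C - t%:C.
Proof. exact: rmorphB. Qed.

Lemma target_form (c p q : R) (k : C) (x y : 'cV[C]_2) :
  (x ^t* *m (k *: (1%:M - target c p *m (target c q) ^t*)) *m y) ord0 ord0 =
  k * (conjc (x ord0 ord0) * y ord0 ord0 + conjc (x ord_max ord0) * y ord_max ord0 -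
    (c ^+ 2)%:C * (conjc ((p ^+ 2)%:C * x ord0 ord0) * ((q ^+ 2)%:C * y ord0 ord0) +
      conjc ((p ^+ 3)%:C * x ord0 ord0 + (p ^+ 2)%:C * x ord_max ord0) *
        ((q ^+ 3)%:C * y ord0 ord0 + (q ^+ 2)%:C * y ord_max ord0))).
Proof.
have [p00 p01 p10 p11] := target_entries c p.
have [q00 q01 q10 q11] := target_entries c q.
move: (target c p) (target c q) p00 p01 p10 p11 q00 q01 q10 q11.
move=> P Q p00 p01 p10 p11 q00 q01 q10 q11.
rewrite -scalemxAr -scalemxAl mxE; congr (_ * _).
rewrite mxE sum_ord2 !mxE !sum_ord2 !mxE !sum_ord2 !mxE /= p00 p01 p10 p11 q00 q01 q10 q11.
by rewrite !conjCc conjc0 conjcD !conjcM !conjc_real !realcM; ring.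
Qed.

(** The vector is conjugated at the index of the first argument of [Kab], so the linear functional
    carries the conjugate parameters; these stay on the unit sphere. *)
Lemma kernel_formE (a b : C) (y : 'I_3 -> C) :
  (kernel_form (conjc a) (conjc b) y)%:C =
  \sum_i \sum_j Kab a b (node i)%:C (node j)%:C * (conjc (y i) * y j).
Proof.
rewrite /kernel_form rmorphD /= szego_formE; last exact: ltr_norm_node.
rewrite (_ : _ + _ * moment _ 1 _ = \sum_i conjc (a + b * (node i)%:C) * y i); last first.
  rewrite /moment !big_distrr -big_split /=; apply: eq_bigr => i _.
  by rewrite expr0 expr1 conjcD conjcM conjc_real; ring.
rewrite sqcE rmorph_sum big_distrl -big_split /=; apply: eq_bigr => i _.
rewrite big_distrr -big_split /=; apply: eq_bigr => j _.
rewrite /Kab !conjCc conjcM conjcK conjc_real.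
rewrite (_ : (_ / (1 - node i * node j))%:C = (node i)%:C ^+ 2 * (node j)%:C ^+ 2 /
   (1 - (node i)%:C * (node j)%:C)); first by ring.
by rewrite fmorph_div rmorphB rmorph1 rmorphXn !rmorphM exprMn.
Qed.

Lemma target_psd (a b : C) : `|a| ^+ 2 + `|b| ^+ 2 = 1 ->
  psdmx (\mxblock_(i < 3, j < 3)
    (Kab a b (node i)%:C (node j)%:C *:
      (1%:M - target (13 / 20) (node i) *m (target (13 / 20) (node j)) ^t*))).
Proof.
move=> ab v; rewrite -(submxcolK v); set V := fun i => submxcol v i.
rewrite (_ : _ ^t* = \mxrow_i (V i) ^t*); last by apply/matrixP => i j; rewrite !mxE.
rewrite mul_mxrow_mxblock mul_mxrow_mxcol summxE.
have ab' : sqc (conjc a) + sqc (conjc b) = 1.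
  apply: (@complexI R); rewrite rmorphD /= !sqcE !conjcK rmorph1 -ab.
  by rewrite -!sqr_normc.
pose u i := V i ord0 ord0; pose w i := V i ord_max ord0.
have := kernel_form_contractive u w ab' erefl; rewrite -ler0c.
set q : R := (X in X%:C); rewrite [X in _ -> _ <= X](_ : _ = q%:C)//.
transitivity (\sum_j \sum_i Kab a b (node i)%:C (node j)%:C *
  (conjc (u i) * u j + conjc (w i) * w j - ((13 / 20) ^+ 2)%:C *
    (conjc (dil 2 u i) * dil 2 u j + conjc (dil 3 u i + dil 2 w i) * (dil 3 u j + dil 2 w j)))).
  apply: eq_bigr => j _; rewrite mulmx_suml summxE; apply: eq_bigr => i _.
  by rewrite target_form.
rewrite exchange_big /= /q realcB (realcM ((13 / 20) ^+ 2)) (realcD (kernel_form _ _ u)).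
rewrite (realcD (kernel_form _ _ (dil 2 u))) !kernel_formE.
rewrite -!big_split mulr_sumr -sumrB; apply: eq_bigr => i _.
rewrite -!big_split mulr_sumr -sumrB; apply: eq_bigr => j _ /=.
by ring.
Qed.

End PickMatrix.

(** * Nonexistence of a matrix interpolant *)

Section OperatorNorm.
Context {R : realType}.
Local Notation C := R[i].

Lemma sqc_normc (z : C) : sqc z = normc z ^+ 2.
Proof. by rewrite sqr_normc_ReIm. Qed.

Lemma addsqc_ge0 (z w : C) : 0 <= sqc z + sqc w.
Proof. exact: addr_ge0 (sqc_ge0 z) (sqc_ge0 w). Qed.

Lemma normc_le_sqc (z : C) (M : R) : 0 <= M -> (normc z <= M) = (sqc z <= M ^+ 2).
Proof. by move=> M0; rewrite sqc_normc ler_pXn2r// nnegrE normc_ge0. Qed.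

Lemma l2norm2 (v : 'cV[C]_2) :
  l2norm v = Num.sqrt (sqc (v ord0 ord0) + sqc (v ord_max ord0)).
Proof.
rewrite /l2norm big_ord_recl big_ord1 !sqc_normc; congr (Num.sqrt (_ + normc (v _ _) ^+ 2)).
exact: val_inj.
Qed.

Lemma l2norm2_le1 (v : 'cV[C]_2) :
  (l2norm v <= 1) = (sqc (v ord0 ord0) + sqc (v ord_max ord0) <= 1).
Proof. by rewrite l2norm2 -[in LHS]sqrtr1 ler_sqrt. Qed.

Lemma mulmx_col2 (A : 'M[C]_2) (v : 'cV[C]_2) i :
  (A *m v) i ord0 = A i ord0 * v ord0 ord0 + A i ord_max * v ord_max ord0.
Proof. by rewrite mxE sum_ord2. Qed.

Lemma le_opnorm (A : 'M[C]_2) (v : 'cV[C]_2) : l2norm v <= 1 -> l2norm (A *m v) <= opnorm A.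
Proof.
move=> v1; apply: ub_le_sup; last by exists v.
(* The Frobenius norm bounds the set, so [sup] is a genuine supremum and not a default value. *)
exists (Num.sqrt (sqc (A ord0 ord0) + sqc (A ord0 ord_max) +
  (sqc (A ord_max ord0) + sqc (A ord_max ord_max)))) => _ [w /= + <-].
rewrite l2norm2_le1 => w1; rewrite l2norm2 !mulmx_col2 ler_sqrt; last first.
  by rewrite (addr_ge0 (addsqc_ge0 _ _) (addsqc_ge0 _ _)).
by apply: lerD; apply: le_trans (sqc_CS _ _ _ _) _; rewrite ler_piMr ?addsqc_ge0.
Qed.

Lemma opnorm_bilinear (A : 'M[C]_2) (l0 l1 v0 v1 : C) :
  opnorm A <= 1 -> sqc l0 + sqc l1 <= 1 -> sqc v0 + sqc v1 <= 1 ->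
  sqc (l0 * (A ord0 ord0 * v0 + A ord0 ord_max * v1) +
       l1 * (A ord_max ord0 * v0 + A ord_max ord_max * v1)) <= 1.
Proof.
move=> A1 l1' v1'; pose v : 'cV[C]_2 := \col_i (if i == ord0 then v0 else v1).
have vE0 : v ord0 ord0 = v0 by rewrite mxE eqxx.
have vE1 : v ord_max ord0 = v1 by rewrite mxE.
have vle1 : l2norm v <= 1 by rewrite l2norm2_le1 vE0 vE1.
have := le_trans (le_opnorm A vle1) A1; rewrite l2norm2_le1 !mulmx_col2 vE0 vE1.
move=> h; apply: le_trans (sqc_CS _ _ _ _) _.
by rewrite mulr_ile1 ?addsqc_ge0.
Qed.

Lemma supnorm_le1 (f : C -> 'M[C]_2) z : (supnorm f <= 1)%E -> disk z -> opnorm (f z) <= 1.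
Proof.
move=> f1 zD; rewrite -lee_fin; apply: le_trans f1.
by apply: ereal_sup_ubound; exists z.
Qed.

End OperatorNorm.

(** * Dividing out zeros *)

Section Division.
Context {R : realType}.
Local Notation C := R[i].

Lemma near_holo (f g : C -> C) z d : 0 < d ->
  (forall w, normc (w - z) < d -> f w = g w) -> holo f z -> holo g z.
Proof.
move=> d0 fg; apply: near_eq_derivable; exists d%:C; first by rewrite /= ltcR.
by move=> w /=; rewrite distrC ltr_normc; exact: fg.
Qed.

Lemma near_contc (f g : C -> C) z d : 0 < d ->
  (forall w, normc (w - z) < d -> f w = g w) -> contc f z -> contc g z.
Proof.
move=> d0 fg cf e /cf[d' d'0 fd]; exists (Num.min d d'); first by rewrite lt_min d0.
move=> w; rewrite lt_min => /andP[wd wd']; rewrite -!fg ?subrr ?normc0//; exact: fd.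
Qed.

(** Carries to 0, by continuity, an identity obtained elsewhere by cancelling a factor [z]. *)
Lemma contc_eq (f g : C -> C) d : 0 < d -> contc f 0 -> contc g 0 ->
  (forall z, z != 0 -> normc z < d -> f z = g z) -> f 0 = g 0.
Proof.
move=> d0 cf cg fg; apply/eqP; rewrite -subr_eq0; apply/eqP/eq0_normc/eqP.
rewrite eq_le normc_ge0 andbT; apply/ler_addgt0Pr => e e0; rewrite add0r.
have e2 : 0 < e / 2 by rewrite divr_gt0.
have [d1 d10 h1] := cf _ e2; have [d2 d20 h2] := cg _ e2.
pose m := Num.min d (Num.min d1 d2) / 2.
have m0 : 0 < m by rewrite divr_gt0// !lt_min d0 d10.
have [md [md1 md2]] : m < d /\ m < d1 /\ m < d2.
  have mlt (x : R) : 0 < x -> Num.min d (Num.min d1 d2) <= x -> m < x by rewrite /m; lra.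
  by split; [|split]; apply: mlt => //; rewrite !ge_min lexx ?orbT.
have nm : normc (m%:C) = m by rewrite normc_real gtr0_norm.
have mz : m%:C != 0 :> C by rewrite -(rmorph0 (real_complex R)) (inj_eq (@complexI R)) gt_eqF.
have := h1 m%:C; have := h2 m%:C; rewrite subr0 nm => /(_ md2) g0 /(_ md1) f0.
rewrite (_ : f 0 - g 0 = (g m%:C - g 0) - (f m%:C - f 0)); last by rewrite (fg _ mz) ?nm//; ring.
by rewrite (le_trans (ler_normcB _ _))// [leRHS]splitr lerD// ltW.
Qed.

Lemma cderiv_subr (f : C -> C) (k z l : C) : cderiv f z l -> cderiv (fun w => f w - k) z l.
Proof.
move=> df e /df[d d0 fd]; exists d => // w /fd.
by rewrite (_ : f w - k - (f z - k) = f w - f z)//; ring.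
Qed.

(* Holomorphy of the quotient at a would need the removable singularity theorem,
   and continuity there is all that the maximum principle asks for. *)
Lemma division_at_zero (f : C -> C) (S : seq C) (a l : C) :
  (forall z, normc z < 1 -> contc f z) ->
  (forall z, normc z < 1 -> z \notin S -> holo f z) ->
  f a = 0 -> cderiv f a l ->
  exists g, [/\ g a = l, (forall z, f z = (z - a) * g z),
    (forall z, normc z < 1 -> contc g z) &
    (forall z, normc z < 1 -> z \notin a :: S -> holo g z)].
Proof.
move=> cf hf fa df; pose g z := if z == a then l else f z / (z - a).
have geq z : z != a -> exists2 d : R, 0 < d & forall w, normc (w - z) < d -> f w / (w - a) = g w.
  move=> za; exists (normc (z - a)).
    rewrite lt_neqAle normc_ge0 andbT eq_sym; apply: contraNneq za => /eq0_normc/eqP.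
    by rewrite subr_eq0.
  move=> w wz; rewrite /g; case: eqVneq => // wa.
  by move: wz; rewrite wa normcB ltxx.
exists g; split.
- by rewrite /g eqxx.
- move=> z; rewrite /g; case: eqVneq => [->|za]; first by rewrite fa subrr mul0r.
  by rewrite mulrC divfK// subr_eq0.
- move=> z z1; have [->|za] := eqVneq z a; last first.
    have [d d0 fg] := geq z za; apply: (near_contc d0 fg).
    by apply: contcM; [exact: cf|exact: contc_inv].
  move=> e e0; have e2 : 0 < e / 2 by rewrite divr_gt0.
  have [d d0 fd] := df _ e2; exists d => // w /fd; rewrite fa subr0 {2}/g eqxx /g.
  case: eqVneq => [->|wa]; first by move=> *; rewrite subrr normc0.
  have wa0 : w - a != 0 by rewrite subr_eq0.
  rewrite (_ : f w - _ = (f w / (w - a) - l) * (w - a)); last by field.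
  have n0 : 0 < normc (w - a).
    by rewrite lt_neqAle normc_ge0 andbT eq_sym; apply: contraNneq wa0 => /eq0_normc ->.
  by rewrite normcM ler_pM2r// => h; lra.
- move=> z z1; rewrite inE negb_or => /andP[za zS].
  have [d d0 fg] := geq z za; apply: (near_holo d0 fg).
  exact: (holo_divB za (hf z z1 zS)).
Qed.

End Division.

Section Nonexistence.
Context {R : realType}.
Local Notation C := R[i].

Lemma contcD (f g : C -> C) z : contc f z -> contc g z -> contc (fun w => f w + g w) z.
Proof.
move=> cf cg e e0; have e2 : 0 < e / 2 by rewrite divr_gt0.
have [d1 d10 fd] := cf _ e2; have [d2 d20 gd] := cg _ e2.
exists (Num.min d1 d2); first by rewrite lt_min d10.
move=> w; rewrite lt_min => /andP[/fd fe /gd ge].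
rewrite (_ : _ - _ = (f w - f z) + (g w - g z)); last by ring.
by rewrite (le_lt_trans (le_normcD _ _))// [e in _ < e]splitr ltrD.
Qed.

Lemma holo_contc (f : C -> C) z : holo f z -> contc f z.
Proof. by move=> hf; exact: (cdiff_contc (holo_cdiff hf)). Qed.

Definition cnode (i : 'I_3) : C := (node i)%:C.
Definition cnodes : seq C := [seq cnode i | i <- enum 'I_3].

Lemma node_inj : injective (@node R).
Proof.
by move=> [[|[|[|//]]] ?] [[|[|[|//]]] ?]; rewrite /node /= => e; apply: val_inj => //=; exfalso; lra.
Qed.

Lemma cnode_inj : injective cnode.
Proof. by move=> i j /(@complexI R) /node_inj. Qed.

Lemma node_neq0 i : node i != 0 :> R.
Proof.
by case: i => -[|[|[|//]]] ?; rewrite /node /=; apply/eqP; lra.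
Qed.

Lemma normc_cnode i : normc (cnode i) < 1.
Proof. by rewrite normc_real ltr_norm_node. Qed.

Definition node_poly (z : C) : C := \prod_i (z - cnode i).

Lemma node_polyE z : node_poly z =
  z ^+ 3 - (1 / 1000)%:C * z ^+ 2 - ((1 / 100) ^+ 2)%:C * z + ((1 / 100) ^+ 2 * (1 / 1000))%:C.
Proof.
rewrite /node_poly !big_ord_recl big_ord0 /cnode /node /=.
have rN (x : R) : (- x)%:C = - x%:C by exact: rmorphN.
rewrite rN expr2 !realcM; ring.
Qed.

(** The zeros are divided out one at a time. As the nodes are distinct, each partial quotient still
    vanishes at the next node and is holomorphic there, as [division_at_zero] requires. *)
Lemma cubic_division (h : C -> C) :
  (forall z, normc z < 1 -> holo h z) -> (forall i, h (cnode i) = 0) ->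
  exists g, [/\ forall z, h z = node_poly z * g z,
    forall z, normc z < 1 -> contc g z &
    forall z, normc z < 1 -> z \notin cnodes -> holo g z].
Proof.
move=> hh h0.
suff [g [gE cg hg]] : exists g, [/\
    forall z, h z = (\prod_(i <- enum 'I_3) (z - cnode i)) * g z,
    forall z, normc z < 1 -> contc g z &
    forall z, normc z < 1 -> z \notin cnodes -> holo g z].
  by exists g; split=> // z; rewrite gE big_enum.
rewrite /cnodes; elim: (enum _) (enum_uniq 'I_3) => [_|i s IH /= /andP[iS us]].
  by exists h; split=> [z|z z1|z z1 _]; [rewrite big_nil mul1r|exact/holo_contc/hh|exact: hh].
have [g [gE cg hg]] := IH us.
have iS' : cnode i \notin [seq cnode j | j <- s] by rewrite (mem_map cnode_inj).
have gi : g (cnode i) = 0.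
  apply/eqP; have /eqP := h0 i; rewrite gE mulf_eq0 => /orP[|//].
  rewrite prodf_seq_eq0 => /hasP[j js /andP[_]]; rewrite subr_eq0 => /eqP /cnode_inj ij.
  by rewrite ij js in iS.
have [l gl] := holo_cdiff (hg _ (normc_cnode i) iS').
have [k [_ kE ck hk]] := division_at_zero cg hg gi gl.
exists k; split=> // z.
by rewrite gE kE big_cons; ring.
Qed.

Lemma maximum_principle_ring (g : C -> C) (S : seq C) (M : R) :
  (forall z, normc z < 1 -> contc g z) ->
  (forall z, normc z < 1 -> z \notin S -> holo g z) ->
  (forall z, 999 / 1000 <= normc z < 1 -> normc (g z) <= M) ->
  forall z, normc z < 1 -> normc (g z) <= M.
Proof.
move=> cg hg gM; apply: (maximum_principle cg hg) => e e0.
exists (999 / 1000); first by lra.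
by move=> z /gM; lra.
Qed.

(** The distances to the nodes are at least 0.989, 0.989 and 0.998, with product above 0.976. *)
Lemma node_poly_ge z : 999 / 1000 <= normc z -> 976 / 1000 <= normc (node_poly z).
Proof.
move=> z1; have far i : normc z - `|node i| <= normc (z - cnode i).
  have := le_normcD (z - cnode i) (cnode i); rewrite subrK normc_real; lra.
rewrite /node_poly !big_ord_recl big_ord0 mulr1 !normcM.
have h0 := far ord0; have h1 := far (lift ord0 ord0).
have h2 := far (lift ord0 (lift ord0 ord0)).
move: (normc (z - cnode ord0)) (normc (z - cnode (lift ord0 ord0))) h0 h1.
move: (normc (z - cnode (lift ord0 (lift ord0 ord0)))) h2.
rewrite /node /= normrN !ger0_norm; try lra.
move=> p2 h2 p0 p1 h0 h1; move: z1 h0 h1 h2; clear => z1 h0 h1 h2.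
have a0 : 989 / 1000 <= p0 by lra.
have a1 : 989 / 1000 <= p1 by lra.
have a2 : 998 / 1000 <= p2 by lra.
clear z1 h0 h1 h2.
have h : 989 / 1000 * (998 / 1000) <= p1 * p2 by apply: ler_pM; lra.
by apply: le_trans (ler_pM _ _ a0 h); clear; lra.
Qed.

End Nonexistence.

(** * Estimates of the quotients at 0 *)

Section Contradiction.
Context {R : realType}.
Local Notation C := R[i].
Local Notation c := (13 / 20 : R).

Unset Implicit Arguments.

Lemma holo_scale (k : C) {f : C -> C} {z : C} : holo f z -> holo (fun w => k * f w) z.
Proof. by move=> hf; exact: (holoM (holo_cst k z) hf). Qed.

Lemma holo_mono (k : C) n (z : C) : holo (fun w => k * w ^+ n) z.
Proof. exact: (holo_scale k (holoX n (holo_id z))). Qed.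

Set Implicit Arguments.

Lemma normc_cR (x : R) : 0 <= x -> normc (x%:C) = x.
Proof. by move=> x0; rewrite normc_real ger0_norm. Qed.

(* Comparing the terms of order 1 at 0 gives g(0) = g'(0) / 1000. *)
Lemma error_quotient_at0 (h g : C -> C) :
  (forall z, normc z < 1 -> holo h z) -> cderiv h 0 0 ->
  (forall z, normc z < 1 -> normc (h z) <= 1) ->
  (forall z, h z - c%:C * z ^+ 3 = node_poly z * g z) ->
  (forall z, normc z < 1 -> contc g z) ->
  (forall z, normc z < 1 -> z \notin cnodes -> holo g z) ->
  normc (g 0) <= 1 / 250.
Proof.
move=> hh dh0 h1 gE cg hg.
have zero1 : normc (0 : C) < 1 by rewrite normc0.
have zS : (0 : C) \notin cnodes.
  apply/mapP => -[i _ /(@complexI R) /esym/eqP]; exact/negP/node_neq0.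
(* Near the circle |g| is at most (1 + 13/20) / 0.976, which is below 17 / 10. *)
have gB z : normc z < 1 -> normc (g z) <= 17 / 10.
  apply: (maximum_principle_ring cg hg) => w /andP[w0 w1].
  have P := node_poly_ge w0.
  have : normc (h w - c%:C * w ^+ 3) <= 1 + c.
    rewrite (le_trans (ler_normcB _ _))// lerD ?h1// normcM normcX normc_cR; last lra.
    by rewrite ler_piMr ?exprn_ile1 ?normc_ge0 ?(ltW w1)//; lra.
  rewrite gE normcM => h2.
  have := normc_ge0 (g w); have := ler_wpM2r (normc_ge0 (g w)) P.
  by move: h2; clear; lra.
have [l gl] := holo_cdiff (hg 0 zero1 zS).
have [k [k0 kE ck hk]] := @division_at_zero R (fun z => g z - g 0) cnodes 0 l
  (fun z z1 => contcD (cg z z1) (@contc_cst R _ z))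
  (fun z z1 zs => holoB (hg z z1 zs) (holo_cst (g 0) z)) (subrr _) (cderiv_subr (g 0) gl).
have kB z : normc z < 1 -> normc (k z) <= 7 / 2.
  apply: (maximum_principle_ring ck hk) => w /andP[w0 w1].
  have := ler_normcB (g w) (g 0); have := gB w w1; have := gB 0 zero1.
  rewrite kE subr0 normcM; have := normc_ge0 (k w); have := ler_wpM2r (normc_ge0 (k w)) w0.
  by clear; lra.
(* The hypothesis h'(0) = 0 enters here, as [m 0 = 0]. *)
have [m [m0 mE cm _]] := @division_at_zero R (fun z => h z - h 0) [::] 0 0
  (fun z z1 => contcD (holo_contc (hh z z1)) (@contc_cst R _ z))
  (fun z z1 _ => holoB (hh z z1) (holo_cst (h 0) z)) (subrr _) (cderiv_subr (h 0) dh0).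
pose e2 : C := ((1 / 100) ^+ 2)%:C; pose e3 : C := ((1 / 100) ^+ 2 * (1 / 1000))%:C.
pose q (z : C) := z ^+ 2 - (1 / 1000)%:C * z - e2.
have PE z : node_poly z = e3 + z * q z by rewrite node_polyE /q /e3 /e2; ring.
have cid z : contc (fun w : C => w) z by apply: holo_contc; exact: holo_id.
have cq : contc q 0.
  rewrite (_ : q = fun z => (1%:C * z ^+ 2 + (- (1 / 1000)%:C) * z ^+ 1) + - e2); last first.
    by apply/funext => z; rewrite /q; ring.
  by apply: holo_contc; exact: (holoD (holoD (holo_mono _ 2 _) (holo_mono _ 1 _)) (holo_cst _ _)).
(* Subtract from h - c z^3 = node_poly * g its value at 0, divide by [z] and let [z] tend to 0. What
   remains is e2 * g 0 = e3 * k 0 with e3 / e2 = 1 / 1000 and |k 0| <= 7 / 2. *)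
have : m 0 - c%:C * 0 ^+ 2 = q 0 * g 0 + (e3 * k 0 + 0 * (q 0 * k 0)).
  apply: (@contc_eq _ (fun z => m z - c%:C * z ^+ 2)
    (fun z => q z * g 0 + (e3 * k z + z * (q z * k z))) 1 ltr01).
  - apply: (contcD (cm 0 zero1)); apply: holo_contc.
    rewrite (_ : (fun _ => _) = fun z : C => (- c%:C) * z ^+ 2); first exact: holo_mono.
    by apply/funext => z; rewrite mulNr.
  - apply: contcD; first exact: (contcM cq (@contc_cst R (g 0) 0)).
    apply: contcD; first exact: (contcM (@contc_cst R e3 0) (ck 0 zero1)).
    exact: (contcM (cid 0) (contcM cq (ck 0 zero1))).
  - move=> z z0 z1; apply: (mulfI z0).
    have := gE z; have := gE 0; have := mE z; have := kE z; rewrite !subr0 !PE mul0r addr0.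
    rewrite expr0n mulr0 subr0 => kz mz h0 hz.
    rewrite mulrBr -mz h0.
    have -> : z * (c%:C * z ^+ 2) = h z - (e3 + z * q z) * g z by rewrite -hz; ring.
    have -> : g z = z * k z + g 0 by rewrite -kz subrK.
    by ring.
rewrite m0 expr0n mulr0 mul0r addr0 subr0 /q expr0n mulr0 subr0 sub0r mulNr.
move=> /esym/eqP; rewrite addrC subr_eq0 => /eqP eg.
have : normc (e2 * g 0) = normc (e3 * k 0) by rewrite -eg.
rewrite !normcM /e2 /e3 !normc_cR; try lra.
by have := kB 0 zero1; have := normc_ge0 (k 0); clear; lra.
Qed.

Lemma disk_normc (z : C) : disk z <-> normc z < 1.
Proof. by rewrite /disk /= -(rmorph1 (real_complex R)) ltr_normc. Qed.

Lemma matrix_interpolation_impossible (f : C -> 'M[C]_2) :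
  mxHoo1 f -> (supnorm f <= 1)%E ->
  (forall i, f (cnode i) = target c (node i)) -> False.
Proof.
move=> fH f1 fW.
have hf i j z : normc z < 1 -> holo (fun w => f w i j) z.
  by move=> /disk_normc zD; have [hz _ _] := fH i j; exact: hz.
have op1 z : normc z < 1 -> opnorm (f z) <= 1.
  by move=> /disk_normc; exact: supnorm_le1.
have zero1 : normc (0 : C) < 1 by rewrite normc0.
have d01 : cderiv (fun z => f z ord0 ord_max) 0 0.
  have [_ _] := fH ord0 ord_max; rewrite derive1E => e.
  rewrite -[X in cderiv _ _ X]e; exact: (derivable_cderiv (hf ord0 ord_max 0 zero1)).
have sqc0 : sqc (0 : C) = 0 by rewrite -(rmorph0 (real_complex R)) sqcR expr0n.
have sqc1 : sqc (1 : C) = 1 by rewrite -(rmorph1 (real_complex R)) sqcR expr1n.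
have b01 z : normc z < 1 -> normc (f z ord0 ord_max) <= 1.
  move=> z1; have := @opnorm_bilinear R (f z) 1 0 0 1 (op1 z z1).
  rewrite sqc0 sqc1 addr0 add0r lexx mulr0 mulr1 add0r mul1r mul0r addr0.
  by rewrite normc_le_sqc ?ler01// expr1n; exact.
have quot (i j : 'I_2) (k : C) n :
    (forall l, target c (node l) i j = k * cnode l ^+ n) ->
    exists g, [/\ forall z, f z i j - k * z ^+ n = node_poly z * g z,
      forall z, normc z < 1 -> contc g z &
      forall z, normc z < 1 -> z \notin cnodes -> holo g z].
  move=> tE; apply: cubic_division => [z z1|l]; last by rewrite fW tE subrr.
  exact: (holoB (hf i j z z1) (holo_mono k n z)).
have cE l n : (c * node l ^+ n)%:C = c%:C * cnode l ^+ n by rewrite rmorphM rmorphXn.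
have [g00 [E00 c00 h00]] := quot ord0 ord0 c%:C 2
  (fun l => let: And4 e _ _ _ := target_entries c (node l) in etrans e (cE l 2)).
have [g01 [E01 c01 h01]] := quot ord0 ord_max c%:C 3
  (fun l => let: And4 _ e _ _ := target_entries c (node l) in etrans e (cE l 3)).
have [g10 [E10 c10 h10]] := quot ord_max ord0 0 0
  (fun l => let: And4 _ _ e _ := target_entries c (node l) in etrans e (esym (mul0r _))).
have [g11 [E11 c11 h11]] := quot ord_max ord_max c%:C 2
  (fun l => let: And4 _ _ _ e := target_entries c (node l) in etrans e (cE l 2)).
have g0 := error_quotient_at0 (hf ord0 ord_max) d01 b01 E01 c01 h01.
(* The function l f v - 8 c z^3 is [node_poly] times [T] without its constant. Adding 8 c leaves
   node_poly * T = l f v - 8 c (z^3 - node_poly), where z^3 - node_poly is small. *)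
pose T z := 2%:C * (g00 z * z + 2%:C * g01 z) + z * (g10 z * z + 2%:C * g11 z) + (8 * c)%:C.
have two : 2%:C = 2 :> C by exact: (rmorph_nat (real_complex R) 2).
have eight : (8 * c)%:C = 8 * c%:C :> C.
  by rewrite realcM; congr (_ * _); exact: (rmorph_nat (real_complex R) 8).
have cid z : contc (fun w : C => w) z by exact: (holo_contc (holo_id z)).
(* The numerator is at most 5 + 5.2 * 0.0012 near the circle, and dividing by 0.976 stays below
   5.13. *)
have TB z : normc z < 1 -> normc (T z) <= 513 / 100.
  apply: (@maximum_principle_ring R T cnodes) => {}z z1.
  - have ck (k : C) : contc (fun=> k) z by exact: contc_cst.
    apply: contcD (ck _); apply: contcD.
      exact: (contcM (ck _) (contcD (contcM (c00 z z1) (cid z)) (contcM (ck _) (c01 z z1)))).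
    exact: (contcM (cid z) (contcD (contcM (c10 z z1) (cid z)) (contcM (ck _) (c11 z z1)))).
  - move=> zs; have hk (k : C) := holo_cst k z; have hid := holo_id z.
    apply: holoD (hk _); apply: holoD.
      exact: (holoM (hk _) (holoD (holoM (h00 z z1 zs) hid) (holoM (hk _) (h01 z z1 zs)))).
    exact: (holoM hid (holoD (holoM (h10 z z1 zs) hid) (holoM (hk _) (h11 z z1 zs)))).
  - move: z1 => /andP[z0 z1]; have P := node_poly_ge z0.
    (* The vectors (2, z) and (z, 2) have squared norm at most 5, so [t] scales them into the unit
       ball. *)
    pose t : R := Num.sqrt (1 / 5); have t2 : t ^+ 2 = 1 / 5 by rewrite sqr_sqrtr//; lra.
    have sz : sqc z <= 1 by rewrite sqc_normc exprn_ile1 ?normc_ge0// ltW.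
    pose Phi := 2%:C * (f z ord0 ord0 * z + 2%:C * f z ord0 ord_max) +
      z * (f z ord_max ord0 * z + 2%:C * f z ord_max ord_max).
    have Phi5 : normc Phi <= 5.
      rewrite normc_le_sqc; last lra.
      have := @opnorm_bilinear R (f z) (t%:C * 2%:C) (t%:C * z) (t%:C * z) (t%:C * 2%:C) (op1 z z1).
      rewrite (_ : _ + t%:C * z * _ = (t ^+ 2)%:C * Phi); last by rewrite /Phi rmorphXn /=; ring.
      by rewrite !sqcM !sqcR t2 => /(_ _ _) H; have := H; lra.
    have PT : node_poly z * T z = Phi - (8 * c)%:C *
       ((1 / 1000)%:C * z ^+ 2 + (((1 / 100) ^+ 2)%:C * z - ((1 / 100) ^+ 2 * (1 / 1000))%:C)).
      rewrite (_ : node_poly z * T z =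
         2%:C * ((node_poly z * g00 z) * z + 2%:C * (node_poly z * g01 z)) +
         z * ((node_poly z * g10 z) * z + 2%:C * (node_poly z * g11 z)) + (8 * c)%:C * node_poly z).
        rewrite -E00 -E01 -E10 -E11 node_polyE /Phi two eight.
        by ring.
      by rewrite /T; ring.
    have sz1 : normc (z ^+ 2) <= 1 by rewrite normcX exprn_ile1 ?normc_ge0// ltW.
    have small : normc (node_poly z * T z) <= 5 + 8 * c * (12 / 1000 / 10).
      rewrite PT (le_trans (ler_normcB _ _))// lerD// normcM normc_cR; last lra.
      apply: ler_wpM2l; first lra.
      apply: le_trans (le_normcD _ _) _; rewrite normcM.
      have := ler_normcB (((1 / 100) ^+ 2)%:C * z) ((1 / 100) ^+ 2 * (1 / 1000))%:C.
      rewrite normcM !normc_cR; [|lra..].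
      by move: (ltW z1) sz1 (normc_ge0 z) (normc_ge0 (z ^+ 2)); clear; lra.
    move: small; rewrite normcM => small.
    have := ler_wpM2r (normc_ge0 (T z)) P; move: small (normc_ge0 (T z)); clear; lra.
(* At 0, T = 4 g01 + 8 c, which forces 8 c = 5.2 <= 5.13 + 4 / 250, a contradiction. *)
have := TB 0 zero1; have := ler_normcB (T 0) (4%:C * g01 0).
have -> : T 0 - 4%:C * g01 0 = (8 * c)%:C.
  by rewrite /T (_ : 4%:C = 2%:C * 2%:C); [ring|rewrite -realcM; congr (_%:C); ring].
by move: g0; rewrite normcM !normc_cR; lra.
Qed.

End Contradiction.

End Development.

Theorem theorem5p1 (R : realType) :
  exists (k : nat) (z : 'I_3 -> R[i]) (W : 'I_3 -> 'M[R[i]]_k),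
    [/\ (1 <= k)%N,
        injective z,
        forall i, z i != 0 /\ disk (z i),
        forall a b : R[i], `|a| ^+ 2 + `|b| ^+ 2 = 1 ->
          psdmx (\mxblock_(i < 3, j < 3)
                   (Kab a b (z i) (z j) *: (1%:M - W i *m (W j) ^t*)))
      & ~ exists f : R[i] -> 'M[R[i]]_k,
            [/\ mxHoo1 f, (supnorm f <= 1)%E & forall i, f (z i) = W i]].
Proof.
exists 2%N, cnode, (fun i => target (13 / 20) (node i)); split=> //.
- exact: cnode_inj.
- move=> i; split; last exact/disk_normc/normc_cnode.
  by rewrite -(rmorph0 (real_complex R)) (inj_eq (@complexI R)) node_neq0.
- exact: target_psd.
- by move=> [f [fH f1 fW]]; exact: (matrix_interpolation_impossible fH f1 fW).
Qed.
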